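(* Let $G$ be a finite simple subcubic graph (i.e. every vertex has degree at most $3$). Then $\chi_{s,l}'(G) \le 10$, i.e. for every assignment $L$ of lists of colors to the edges of $G$ with $|L(e)| \ge 10$ for every $e \in E(G)$, there is a strong edge coloring $\phi$ of $G$ with $\phi(e) \in L(e)$ for all $e \in E(G)$.
   Context: All graphs are finite and simple. A strong edge coloring of a graph $G$ is an assignment of colors to the edges of $G$ such that any two distinct edges that share an endpoint, or that are both incident to a common edge (equivalently, any two distinct edges at distance at most $2$ in the line graph sense, i.e. edges $e,e'$ such that $e$ and $e'$ are adjacent or some third edge is adjacent to both), receive different colors. A $k$-edge list assignment is a map $L$ assigning to each edge $e$ a set $L(e)$ of colors with $|L(e)|\ge k$. The graph $G$ is strongly $k$-edge choosable if for every $k$-edge list assignment $L$ there is a strong edge coloring $\phi$ with $\phi(e)\in L(e)$ for all edges $e$. The strong list-chromatic index $\chi_{s,l}'(G)$ is the minimum positive integer $k$ such that $G$ is strongly $k$-edge choosable. *)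

(* Defs.v *)
From mathcomp Require Import all_boot.
From mathcomp Require Import boolp classical_sets functions cardinality.

Set Implicit Arguments.
Unset Strict Implicit.
Unset Printing Implicit Defensive.

Record sgraph := SGraph {
  vertex :> finType;
  adj : rel vertex;
  adj_sym : symmetric adj;
  adj_irr : irreflexive adj
}.

Definition degree (G : sgraph) (x : G) : nat := #|[pred y | adj x y]|.

Definition subcubic (G : sgraph) : Prop := forall x : G, degree x <= 3.

Definition edge_set (G : sgraph) : {set {set G}} :=
  [set [set xy.1; xy.2] | xy in [pred xy : G * G | adj xy.1 xy.2]].

Notation edge G := {e : {set G} | e \in edge_set G}.

Definition adjacent (G : sgraph) (e f : edge G) : bool :=
  (e != f) && [exists x : G, (x \in val e) && (x \in val f)].

Definition strong_edge_coloring (G : sgraph) (C : Type) (phi : edge G -> C) :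
    Prop :=
  forall e f : edge G, e != f ->
    adjacent e f \/ (exists g : edge G, adjacent g e /\ adjacent g f) ->
    phi e <> phi f.

(* Lists are arbitrary, possibly infinite, subsets of an arbitrary type of
   colors.  Lists and colorings live on the type of edges, so that an edgeless
   graph still has its empty coloring when the type of colors is empty. *)
Definition edge_list_assignment (G : sgraph) (C : Type) (k : nat)
    (L : edge G -> set C) : Prop :=
  forall e : edge G, (`I_k #<= L e)%card.

Definition strongly_edge_choosable (G : sgraph) (k : nat) : Prop :=
  forall (C : Type) (L : edge G -> set C), edge_list_assignment k L ->
    exists phi : edge G -> C,
      strong_edge_coloring phi /\ forall e : edge G, L e (phi e).

Lemma strongly_edge_choosable_ex (G : sgraph) :
  exists k, `[< 0 < k /\ strongly_edge_choosable G k >].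
Proof.
exists #|{: edge G}|.+1; apply/asboolP; split=> // C L HL.
set n := #|{: edge G}|.+1.
have /choice[f Hf] : forall e : edge G, exists f : nat -> C,
    (forall i, i < n -> L e (f i)) /\
    (forall i j, i < n -> j < n -> f i = f j -> i = j).
  move=> e; have /card_leP[f] := HL e.
  pose i0 : `I_n := SigSub (mem_set (ltn0Sn _ : `I_n 0)).
  exists (fun i => set_val (f (insubd i0 i))); split=> [i ilt|i j ilt jlt].
    exact: set_valP.
  move/val_inj/(inj (in_setT _) (in_setT _))/(congr1 val).
  by rewrite !val_insubd !mem_set.
have key : forall s : seq (edge G), uniq s -> exists g : edge G -> nat,
    (forall e, e \in s -> g e < n) /\
    (forall e e', e \in s -> e' \in s -> f e (g e) = f e' (g e') -> e = e').
  elim=> [_|a s IHs /= /andP[as_ us]]; first by exists (fun=> 0).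
  have [g [glt ginj]] := IHs us.
  pose used : seq {classic C} := [seq f e (g e) : {classic C} | e <- s].
  have [i ilt iused] : exists2 i, i < n & (f a i : {classic C}) \notin used.
    apply: contrapT => no.
    have : size (mkseq (f a : nat -> {classic C}) n) <= size used.
      apply: uniq_leq_size.
        rewrite map_inj_in_uniq ?iota_uniq // => i j.
        rewrite !mem_iota !add0n /= => ilt jlt.
        exact: (proj2 (Hf a)).
      move=> c /mapP[i]; rewrite mem_iota add0n /= => ilt ->.
      by apply: contrapT => /negP nu; apply: no; exists i.
    rewrite size_mkseq size_map ltnNge => /negP[].
    by rewrite -(card_uniqP us) max_card.
  have fused e : e \in s -> f a i <> f e (g e).
    by move=> es E; move/negP: iused; apply; apply/mapP; exists e.
  exists (fun e => if e == a then i else g e); split=> [e|e e'].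
    by rewrite inE; case: eqP => //= _ /glt.
  rewrite !inE; case: eqP => [->|_]; case: eqP => [->|_] //= es e's.
  - by move/(fused _ e's).
  - by move/esym/(fused _ es).
  - exact: ginj.
have [g [glt ginj]] := key (enum {: edge G}) (enum_uniq _).
exists (fun e => f e (g e)); split=> [e e' ee' _ E|e].
  by move/eqP: ee'; apply; apply: ginj; rewrite ?mem_enum.
by apply: (proj1 (Hf e)); apply: glt; rewrite mem_enum.
Qed.

Definition strong_list_chromatic_index (G : sgraph) : nat :=
  ex_minn (strongly_edge_choosable_ex G).

(* Main.v *)
From Stdlib Require Import BinInt.
From mathcomp Require Import all_boot all_order all_algebra.
From mathcomp Require Import ssrZ ring zify.
Require Import Defs.

(** An edge of a subcubic graph conflicts with at most 12 others, and with at
    most 9 coloured ones when one of its ends has degree at most 2 or has a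
    neighbour all of whose edges are still uncoloured.  Hence the edges avoiding
    a vertex set S can be coloured greedily, far edges first, and it is enough
    to choose S inside a cubic part of the graph such that the edges meeting S
    can be coloured last.  For S a shortest cycle of length at least 7 the
    remaining lists have at least 6 colours on the cycle edges and at least 4 on
    the pendant edges; by the Combinatorial Nullstellensatz these lists suffice
    as soon as a suitable coefficient of the product of the differences over all
    conflicts does not vanish.  Expanding that product along the cycle with a
    transfer operator, the coefficient is periodic in the length of the cycle.
    For a shortest cycle of length 3 to 6 further adjacencies and coincidences
    near the cycle may occur; a case tree enumerates them, enlarging S where
    needed, with one nonzero coefficient for each case. *)

Set Implicit Arguments.
Unset Strict Implicit.
Unset Printing Implicit Defensive.

Import GRing.Theory Num.Theory.

(** * The Combinatorial Nullstellensatz for products of differences *)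

(** Once the other edges are coloured, greedy colouring also fails around a long shortest cycle of
    length [k]: among the edges meeting it, a cycle edge conflicts with eight others and a pendant
    edge with six, while their lists may keep only six and four colours. The exponents are thus at
    most 5 and 3, that is 8 per pair of a cycle edge and a pendant edge, and they must add up to the
    number of conflicts, which is (8 + 6) / 2 = 7 per pair. The usual exponents (5, 2) attain this
    exactly; the deviating pairs (5, 3) and (3, 3) keep the average. Length 7 is the threshold
    because an edge between third neighbours of two cycle vertices, together with the shorter arc,
    closes a cycle of length at most [k / 2 + 3], which is below [k] as soon as [k] exceeds 6.
    Periodicity is not automatic, since the coefficients of the combinations could grow. It is a
    computed fact: the combinations themselves repeat with period 6 from the fourth iterate on, so
    finitely many values settle all lengths. *)

Definition upd (A : Type) (f : nat -> A) (i : nat) (a : A) : nat -> A :=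
  fun g => if g == i then a else f g.

Definition dec (t : nat -> nat) (i : nat) : nat -> nat := upd t i (t i).-1.

Section Nullstellensatz.
Local Open Scope ring_scope.

(* The coefficient of the monomial with exponents [t g], for [g < n], in the
   product of the differences [x i - x j] over the pairs [(i, j)] of [E]. *)
Fixpoint acoef (n : nat) (E : seq (nat * nat)) (t : nat -> nat) : Z :=
  if E is (i, j) :: E' then
    ((if t i == 0%N then 0 else acoef n E' (dec t i))
    - (if t j == 0%N then 0 else acoef n E' (dec t j)))%R
  else (if all (fun g => t g == 0%N) (iota 0 n) then 1 else 0)%R.

#[global] Arguments acoef : simpl never.

Lemma acoef_cons n i j E t : acoef n ((i, j) :: E) t =
  (if t i == 0%N then 0 else acoef n E (dec t i))
  - (if t j == 0%N then 0 else acoef n E (dec t j)).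
Proof. by []. Qed.

Lemma acoef_nil n t : acoef n [::] t = (all (fun g => t g == 0%N) (iota 0 n))%:R.
Proof. by rewrite /acoef; case: all. Qed.

#[global] Opaque acoef.

Definition below (n : nat) (E : seq (nat * nat)) :=
  all (fun e => (e.1 < n)%N && (e.2 < n)%N) E.

Lemma sum_dec n t i : (i < n)%N -> t i != 0%N ->
  (\sum_(g < n) t g = (\sum_(g < n) dec t i g).+1)%N.
Proof.
move=> ilt ti; rewrite (bigD1 (Ordinal ilt)) //= [in RHS](bigD1 (Ordinal ilt)) //=.
rewrite /dec /upd eqxx -addSn prednK ?lt0n //; congr addn.
by apply: eq_bigr => g; rewrite -val_eqE /= => /negbTE ->.
Qed.

(** The product is homogeneous of degree [size E]. *)
Lemma acoef_degree n E t : below n E -> acoef n E t != 0 ->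
  size E = (\sum_(g < n) t g)%N.
Proof.
elim: E t => [|[i j] E IH] t /=.
  move=> _; rewrite acoef_nil; case: allP => // t0 _; rewrite big1 // => g _.
  by apply/eqP/t0; rewrite mem_iota /= ltn_ord.
rewrite acoef_cons => /andP[/andP[/= ilt jlt] bE] nz.
have [ti|/negbTE ti] := boolP (t i == 0%N).
  move: nz; rewrite ti; have [tj|/negbTE tj] := boolP (t j == 0%N).
    by rewrite subr0 eqxx.
  rewrite sub0r oppr_eq0 => /(IH _ bE) ->.
  by rewrite [RHS](sum_dec jlt) ?tj.
have [e0|/(IH _ bE) ->] := boolP (acoef n E (dec t i) == 0); last first.
  by rewrite [RHS](sum_dec ilt) ?ti.
move: nz; rewrite ti (eqP e0); have [tj|/negbTE tj] := boolP (t j == 0%N).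
  by rewrite subr0 eqxx.
rewrite sub0r oppr_eq0 => /(IH _ bE) ->.
by rewrite [RHS](sum_dec jlt) ?tj.
Qed.

(** Barycentric Lagrange weight of the node [s] of [T]. *)
Definition wt (T : seq rat) (s : rat) : rat := (\prod_(r <- T | r != s) (s - r))^-1.

(** The factor [s - s0] kills the term at [s0] and cancels the matching factor in every other
    weight. *)
Lemma wt_rem (T : seq rat) s0 (Q : rat -> rat) : uniq T -> s0 \in T ->
  \sum_(s <- T) wt T s * ((s - s0) * Q s)
  = \sum_(s <- rem s0 T) wt (rem s0 T) s * Q s.
Proof.
move=> uT s0T; rewrite (perm_big _ (perm_to_rem s0T)) /= big_cons subrr mul0r mulr0.
rewrite add0r big_seq [RHS]big_seq; apply: eq_bigr => s.
rewrite (mem_rem_uniq _ uT) !inE => /andP[ss0 _].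
rewrite {1}/wt (perm_big _ (perm_to_rem s0T)) /= big_cons eq_sym ss0 invfM.
by rewrite mulrACA mulVf ?subr_eq0 // mul1r.
Qed.

(** This is the divided difference of the constant 1. With two nodes [s0] and [s1], the sums
    weighted by [r - s0] and by [r - s1] agree by [wt_rem] and induction; their difference is
    [s1 - s0] times the wanted sum, which is therefore zero. *)
Lemma sum_wt (T : seq rat) : uniq T -> (0 < size T)%N ->
  \sum_(s <- T) wt T s = (size T == 1%N)%:R.
Proof.
have [k] := ubnP (size T); elim: k T => // k IH T Tk uT T0.
case: T uT T0 Tk => [|s0 [|s1 T]] // uT _ Tk.
  by rewrite big_seq1 /wt big_cons eqxx big_nil invr1.
have s10 : s1 != s0 by move: uT; rewrite /= inE negb_or eq_sym => /andP[/andP[]].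
set U := [:: s0, s1 & T]; have sU : size U = (size T).+2 by [].
have s0U : s0 \in U by rewrite mem_head.
have s1U : s1 \in U by rewrite !inE eqxx orbT.
have rm s : s \in U -> \sum_(r <- U) wt U r * (r - s) = (size T == 0%N)%:R.
  move=> sU'; have := wt_rem (fun=> 1) uT sU'.
  under eq_bigr do rewrite mulr1.
  under [X in _ = X -> _]eq_bigr do rewrite mulr1.
  move=> ->; rewrite IH ?rem_uniq // size_rem ?sU //=.
apply: (mulIf (x := s1 - s0)); first by rewrite subr_eq0.
rewrite mul0r mulr_suml -[RHS](subrr (size T == 0%N)%:R) -{1}(rm s0 s0U) -(rm s1 s1U).
rewrite -sumrB; apply: eq_bigr => r _.
by ring.
Qed.

(* With the Lagrange weights, the weighted sum over a grid of side lengths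
   [t g + 1] of a polynomial of degree at most the sum of the [t g] is its
   coefficient at the monomial with exponents [t]: multiplying by [y i - s0]
   amounts to removing [s0] from the side [S i]. *)
Fixpoint Lam (S : nat -> seq rat) (P : (nat -> rat) -> rat) n (x : nat -> rat) : rat :=
  if n is m.+1 then \sum_(s <- S m) wt (S m) s * Lam S P m (upd x m s) else P x.

Lemma eq_Lam S P Q n x : (forall y, P y = Q y) -> Lam S P n x = Lam S Q n x.
Proof.
by move=> PQ; elim: n x => [|n IH] x //=; apply: eq_bigr => s _; rewrite IH.
Qed.

Lemma eq_Lams S S' P n x : (forall i, (i < n)%N -> S i = S' i) ->
  Lam S P n x = Lam S' P n x.
Proof.
elim: n x => [|n IH] x //= SS; rewrite SS //; apply: eq_bigr => s _.
by rewrite IH // => i ilt; apply: SS; apply: ltnW.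
Qed.

Lemma LamD S P Q n x : Lam S (fun y => P y + Q y) n x = Lam S P n x + Lam S Q n x.
Proof.
elim: n x => [|n IH] x //=; rewrite -big_split; apply: eq_bigr => s _.
by rewrite IH mulrDr.
Qed.

Lemma LamZ S P n x a : Lam S (fun y => a * P y) n x = a * Lam S P n x.
Proof.
elim: n x => [|n IH] x //=; rewrite mulr_sumr; apply: eq_bigr => s _.
by rewrite IH mulrCA.
Qed.

Lemma Lam_out S P n i x (a : rat) : (n <= i)%N ->
  Lam S (fun y => (y i - a) * P y) n x = (x i - a) * Lam S P n x.
Proof.
elim: n x => [|n IH] x //= ni; rewrite mulr_sumr; apply: eq_bigr => s _.
by rewrite IH ?(ltnW ni) // {1}/upd gtn_eqF // mulrCA.
Qed.

Lemma Lam_rem S P n i x s0 : (i < n)%N -> uniq (S i) -> s0 \in S i ->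
  Lam S (fun y => (y i - s0) * P y) n x = Lam (upd S i (rem s0 (S i))) P n x.
Proof.
elim: n x => [|n IH] x //=; rewrite ltnS leq_eqVlt => /orP[/eqP -> |ilt] uS sS.
  under eq_bigr do rewrite Lam_out // {1}/upd eqxx.
  rewrite (wt_rem (fun s => Lam S P n (upd x n s))) // {2 3}/upd eqxx.
  apply: eq_bigr => s _; congr (_ * _); apply: eq_Lams => j jlt.
  by rewrite /upd ltn_eqF.
rewrite {2 3}/upd gtn_eqF //; apply: eq_bigr => s _.
by rewrite IH.
Qed.

Lemma Lam_nil S P n i x : (i < n)%N -> S i = [::] -> Lam S P n x = 0.
Proof.
elim: n x => [|n IH] x //=; rewrite ltnS leq_eqVlt => /orP[/eqP <- ->|ilt Si].
  by rewrite big_nil.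
by rewrite big1 // => s _; rewrite IH ?mulr0.
Qed.

Lemma Lam1 S t n x : (forall i, (i < n)%N -> uniq (S i) /\ size (S i) = (t i).+1) ->
  Lam S (fun=> 1) n x = (all (fun g => t g == 0%N) (iota 0 n))%:R.
Proof.
elim: n x => [|n IH] x HS //; rewrite [LHS]/=; have HS' i : (i < n)%N -> _ := fun h => HS i (ltnW h).
under eq_bigr do rewrite (IH _ HS').
rewrite -mulr_suml; have [un sn] := HS n (ltnSn n).
rewrite sum_wt ?sn // eqSS -[n.+1]addn1 iotaD all_cat /= add0n andbT mulrC.
by case: all; case: eqP; rewrite ?mulr0 ?mul0r ?mulr1.
Qed.

Definition vdm (E : seq (nat * nat)) (x : nat -> rat) : rat :=
  \prod_(e <- E) (x e.1 - x e.2).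

Local Notation zr z := ((int_of_Z z)%:~R : rat).

(** The degree is only bounded by the sum of the exponents, because the induction also meets the
    shorter product with unchanged exponents. *)
Lemma Lam_acoef n E t S x :
  (forall i, (i < n)%N -> uniq (S i) /\ size (S i) = (t i).+1) ->
  below n E -> (size E <= \sum_(g < n) t g)%N ->
  Lam S (vdm E) n x = zr (acoef n E t).
Proof.
elim: E t S => [|[i j] E IH] t S HS /= bE sE.
  rewrite (@eq_Lam _ _ (fun=> 1)) => [|y]; last by rewrite /vdm big_nil.
  by rewrite (Lam1 _ HS) acoef_nil; case: all.
rewrite acoef_cons; case/andP: bE => [/andP[/= ilt jlt] bE].
have key l : (l < n)%N -> exists2 s, s \in S l &
    Lam S (fun y => (y l - s) * vdm E y) n x
    = zr (if t l == 0%N then 0 else acoef n E (dec t l)).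
  move=> llt; have [uS sS] := HS l llt.
  have [s sSl] : exists s, s \in S l.
    by case: (S l) sS => // s T _; exists s; rewrite mem_head.
  exists s => //; rewrite Lam_rem //; case: eqP => [t0|/eqP t0].
    rewrite (@Lam_nil _ _ _ l) // /upd eqxx; apply: size0nil.
    by rewrite size_rem // sS t0.
  apply: IH => // [g glt|]; last by rewrite -ltnS -(sum_dec llt t0).
  rewrite /upd /dec /upd; have [gl|gl] := eqVneq g l; last exact: HS.
  by rewrite rem_uniq // size_rem // sS prednK // lt0n.
have [si _ Hi] := key i ilt; have [sj _ Hj] := key j jlt.
(* The factor splits as [(y i - si) - (y j - sj) + (si - sj)]. The first two terms lower one
   exponent each; the constant multiplies a product of too small a degree to contain the monomial
   [t]. *)
have z0 : acoef n E t = 0.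
  apply/eqP/negPn/negP => /(acoef_degree bE) eE.
  by move: sE; rewrite eE ltnn.
rewrite (@eq_Lam _ _ (fun y => (y i - si) * vdm E y +
   ((-1) * ((y j - sj) * vdm E y) + (si - sj) * vdm E y))); last first.
  move=> y; rewrite /vdm big_cons /= mulN1r -mulNr -!mulrDl; congr (_ * _).
  by ring.
rewrite !LamD !LamZ Hi Hj (IH t S) ?z0 ?(ltnW sE) //.
by rewrite mulr0 addr0 mulN1r -rmorphB -raddfB.
Qed.

Lemma Lam_neq0 S P n x : Lam S P n x != 0 ->
  exists2 y, (forall i, (i < n)%N -> y i \in S i) /\ (forall i, (n <= i)%N -> y i = x i)
    & P y != 0.
Proof.
elim: n x => [|n IH] x /= nz; first by exists x.
have [s sS] : exists2 s, s \in S n & Lam S P n (upd x n s) != 0.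
  apply/hasP; apply: contraNT nz => /hasPn h; rewrite big_seq big1 // => s /h.
  by rewrite negbK => /eqP ->; rewrite mulr0.
move=> /IH [y [yS yx] Py]; exists y => //; split=> i.
  rewrite ltnS leq_eqVlt => /orP[/eqP ->|/yS //].
  by rewrite yx // /upd eqxx.
by move=> ni; rewrite yx ?(ltnW ni) // /upd gtn_eqF.
Qed.

(** A nonzero weighted sum has a grid point where the product does not vanish, that is, a choice of
    colours that separates every pair. *)
Theorem acoef_choosable n E t (L : nat -> seq nat) :
  below n E -> acoef n E t != 0 ->
  (forall i, (i < n)%N -> uniq (L i) /\ (t i < size (L i))%N) ->
  exists2 x : nat -> nat, (forall i, (i < n)%N -> x i \in L i)
    & forall i j, (i, j) \in E -> x i != x j.
Proof.
(* The weighted sum equals the coefficient for sides of exactly [t i + 1] nodes, so the lists are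
   truncated. *)
move=> bE nz HL; pose S i : seq rat := [seq k%:R | k <- take (t i).+1 (L i)].
have HS i : (i < n)%N -> uniq (S i) /\ size (S i) = (t i).+1.
  move=> /HL[uL sL]; rewrite size_map size_takel // map_inj_uniq ?take_uniq //.
  by move=> a b /eqP; rewrite eqr_nat => /eqP.
have : Lam S (vdm E) n (fun=> 0) != 0.
  rewrite (Lam_acoef _ HS bE) ?(acoef_degree bE nz) //.
  rewrite intr_eq0; apply: contra nz => /eqP z0.
  by rewrite -(int_of_ZK (acoef n E t)) z0.
move=> /Lam_neq0 [y [yS _] Py].
pose x i := nth 0%N (L i) (index (y i) (S i)).
have ix i : (i < n)%N -> (index (y i) (S i) < (t i).+1)%N.
  by move=> ilt; have [_ <-] := HS i ilt; rewrite index_mem yS.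
have yx i : (i < n)%N -> y i = (x i)%:R.
  move=> ilt; rewrite -[LHS](nth_index 0 (yS i ilt)) (nth_map 0%N).
    by rewrite nth_take ?ix.
  by have [_ sS] := HS i ilt; rewrite -(size_map (fun k => k%:R : rat)) index_mem yS.
exists x => [i ilt|i j ij].
  by apply: mem_nth; apply: leq_trans (ix i ilt) _; have [] := HL i ilt.
have /andP[/= ilt jlt] := allP bE _ ij.
apply: contraNneq Py => xij; rewrite /vdm prodf_seq_eq0; apply/hasP.
by exists (i, j); rewrite //= !yx // xij subrr.
Qed.

End Nullstellensatz.

(** * Expanding products of differences *)

Fixpoint decs (s : seq nat) (i : nat) : seq nat :=
  match s, i with
  | x :: s', 0 => x.-1 :: s'
  | x :: s', i'.+1 => x :: decs s' i'
  | [::], _ => [::]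
  end.

Fixpoint lexcmp (s1 s2 : seq nat) : comparison :=
  match s1, s2 with
  | [::], [::] => Eq
  | [::], _ => Lt
  | _, [::] => Gt
  | x :: s1', y :: s2' => if x < y then Lt else if y < x then Gt else lexcmp s1' s2'
  end.

(* Formal linear combinations of exponent vectors, kept sorted for [lexcmp]:
   decrementing one coordinate preserves the order, so a merge adds them up. *)
Definition combo := seq (seq nat * Z).

Fixpoint cadd (c1 : combo) : combo -> combo :=
  fix aux c2 :=
    match c1, c2 with
    | [::], _ => c2
    | _, [::] => c1
    | (s1, z1) :: c1', (s2, z2) :: c2' =>
      match lexcmp s1 s2 with
      | Eq => let z := Z.add z1 z2 in
              if Z.eqb z Z0 then cadd c1' c2' else (s1, z) :: cadd c1' c2'
      | Lt => (s1, z1) :: cadd c1' c2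
      | Gt => (s2, z2) :: aux c2'
      end
    end.

Definition cstep (pr : pred (seq nat)) (e : nat * nat) (c : combo) : combo :=
  cadd [seq (decs p.1 e.1, p.2) | p <- c & (0 < nth 0 p.1 e.1) && pr (decs p.1 e.1)]
       [seq (decs p.1 e.2, Z.opp p.2) | p <- c & (0 < nth 0 p.1 e.2) && pr (decs p.1 e.2)].

(** The pruning test [pr] sees the factors still to come, so it can discard vectors whose remaining
    coefficient is known to vanish. *)
Fixpoint crun (pr : seq (nat * nat) -> nat * nat -> pred (seq nat))
    (E : seq (nat * nat)) (c : combo) : combo :=
  if E is e :: E' then crun pr E' (cstep (pr E' e) e c) else c.

Definition nopr (E : seq (nat * nat)) (e : nat * nat) : pred (seq nat) := xpredT.

Definition occ (i : nat) (E : seq (nat * nat)) : nat :=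
  foldr (fun e k => (e.1 == i) + (e.2 == i) + k) 0 E.

(* An exponent exceeding the number of remaining factors cannot be used up. *)
Definition occpr (E : seq (nat * nat)) (e : nat * nat) : pred (seq nat) :=
  let k1 := occ e.1 E in let k2 := occ e.2 E in
  fun s => (nth 0 s e.1 <= k1) && (nth 0 s e.2 <= k2).

Definition cfin (c : combo) : Z :=
  foldr (fun p z => if all (eq_op^~ 0) p.1 then Z.add p.2 z else z) Z0 c.

(** Lets a block be expanded on a short vector for the coordinates [rho] that it touches, all other
    exponents being frozen at [t]. This makes the expansion independent of the length of the
    cycle. *)
Definition glob (rho : seq nat) (t : nat -> nat) (s : seq nat) : nat -> nat :=
  fun g => if g \in rho then nth 0 s (index g rho) else t g.

Definition lift2 (rho : seq nat) (e : nat * nat) := (nth 0 rho e.1, nth 0 rho e.2).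

Section Expansion.
Local Open Scope ring_scope.

Definition cval (F : seq nat -> Z) (c : combo) : Z := \sum_(p <- c) p.2 * F p.1.

Lemma size_decs s i : size (decs s i) = size s.
Proof. by elim: s i => [|x s IH] [|i] //=; rewrite IH. Qed.

Lemma nth_decs s i j : (i < size s)%N ->
  nth 0%N (decs s i) j = if j == i then (nth 0%N s j).-1 else nth 0%N s j.
Proof.
elim: s i j => [|x s IH] [|i] [|j] //= ilt.
by rewrite IH.
Qed.

Lemma lexcmp_eq s1 s2 : lexcmp s1 s2 = Eq -> s1 = s2.
Proof.
elim: s1 s2 => [|x s1 IH] [|y s2] //=.
by case: (ltngtP x y) => // -> /IH ->.
Qed.

Lemma cval_cons F p c : cval F (p :: c) = p.2 * F p.1 + cval F c.
Proof. by rewrite /cval big_cons. Qed.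

Lemma cval_cadd F c1 c2 : cval F (cadd c1 c2) = cval F c1 + cval F c2.
Proof.
elim: c1 c2 => [|[s1 z1] c1 IH1] c2.
  by rewrite {2}/cval big_nil add0r; case: c2.
elim: c2 => [|[s2 z2] c2 IH2]; first by rewrite {3}/cval big_nil addr0.
rewrite /=; case e: (lexcmp s1 s2).
- rewrite -(lexcmp_eq e); case: (Z.eqb_spec (Z.add z1 z2) Z0) => z0.
    rewrite IH1 !cval_cons /=.
    have -> : z1 * F s1 + cval F c1 + (z2 * F s1 + cval F c2)
      = (z1 + z2) * F s1 + (cval F c1 + cval F c2) by ring.
    by have -> : z1 + z2 = 0 :> Z; rewrite ?mul0r ?add0r.
  rewrite !cval_cons IH1 /=.
  have -> : Z.add z1 z2 = z1 + z2 by [].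
  by ring.
- by rewrite cval_cons IH1 !cval_cons addrA.
- by rewrite cval_cons IH2 !cval_cons /=; ring.
Qed.

Lemma eq_acoef n E t t' : t =1 t' -> acoef n E t = acoef n E t'.
Proof.
elim: E t t' => [|[i j] E IH] t t' tt.
  by rewrite !acoef_nil; congr (_%:R); congr nat_of_bool; apply: eq_all => g; rewrite tt.
rewrite !acoef_cons !tt.
have dd l : dec t l =1 dec t' l by move=> g; rewrite /dec /upd !tt.
by rewrite (IH _ _ (dd i)) (IH _ _ (dd j)).
Qed.

Lemma acoef_occ n E t g : (g < n)%N -> (occ g E < t g)%N -> acoef n E t = 0.
Proof.
move=> gn; elim: E t => [|[i j] E IH] t /=.
  move=> tg; rewrite acoef_nil; case: allP => // h.
  by have := h g; rewrite mem_iota /= gn => /(_ isT) /eqP t0; rewrite t0 in tg.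
move=> lt; rewrite acoef_cons.
have key l : ((l == g) + occ g E < t g)%N ->
    (if t l == 0%N then 0 else acoef n E (dec t l)) = 0.
  move=> h; case: eqP => // /eqP tl; apply: IH; rewrite /dec /upd.
  by case: (eqVneq g l) h => [->|]; rewrite ?eqxx; lia.
by rewrite !key ?subr0 //; lia.
Qed.

Lemma glob_dec rho t s i : uniq rho -> size s = size rho -> (i < size rho)%N ->
  dec (glob rho t s) (nth 0%N rho i) =1 glob rho t (decs s i).
Proof.
move=> ur ss il g; rewrite /dec /upd /glob mem_nth // index_uniq //.
have [->|gi] := eqVneq g (nth 0%N rho i).
  by rewrite mem_nth // index_uniq // nth_decs ?ss // eqxx.
case: ifP => // gr; rewrite nth_decs ?ss //; case: eqP => // e.
by rewrite -e nth_index ?eqxx in gi.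
Qed.

Lemma glob_nth rho t s i : uniq rho -> (i < size rho)%N ->
  glob rho t s (nth 0%N rho i) = nth 0%N s i.
Proof. by move=> ur il; rewrite /glob mem_nth // index_uniq. Qed.

Lemma glob_iota n t s g : (g < n)%N -> glob (iota 0 n) t s g = nth 0%N s g.
Proof.
move=> gn; have e : g = nth 0%N (iota 0 n) g by rewrite nth_iota.
by rewrite {1}e glob_nth ?iota_uniq ?size_iota.
Qed.

Lemma size_cadd m (c1 c2 : combo) : all (fun p => size p.1 == m) c1 ->
  all (fun p => size p.1 == m) c2 -> all (fun p => size p.1 == m) (cadd c1 c2).
Proof.
elim: c1 c2 => [|[s1 z1] c1 IH1]; first by case.
move=> c2 /= /andP[h1 h1']; elim: c2 => [|[s2 z2] c2 IH2] /=; first by rewrite h1.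
move=> /andP[h2 h2']; case: lexcmp; rewrite ?/= ?h1 ?h2 ?IH1 ?IH2 //= ?h2 //.
by case: ifP => _ /=; rewrite ?h1 IH1.
Qed.

Lemma size_cstep m pr e c : all (fun p => size p.1 == m) c ->
  all (fun p => size p.1 == m) (cstep pr e c).
Proof.
move=> sc; apply: size_cadd; rewrite all_map; apply/allP => p;
  by rewrite mem_filter => /andP[_ /(allP sc)]; rewrite /= size_decs.
Qed.

Lemma size_crun m pr E c : all (fun p => size p.1 == m) c ->
  all (fun p => size p.1 == m) (crun pr E c).
Proof. by elim: E c => [|e E IH] c //= sc; apply/IH/size_cstep. Qed.

(** Only the factors coming from [E] are expanded; [E'] stays symbolic. Pruning is harmless as long
    as each discarded vector has coefficient zero. *)
Lemma crun_ok n rho t E E' pr c :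
  uniq rho -> below (size rho) E ->
  all (fun p => size p.1 == size rho) c ->
  (forall E1 e s, suffix (e :: E1) E -> ~~ pr E1 e s -> size s = size rho ->
     acoef n (map (lift2 rho) E1 ++ E') (glob rho t s) = 0) ->
  cval (fun s => acoef n (map (lift2 rho) E ++ E') (glob rho t s)) c
  = cval (fun s => acoef n E' (glob rho t s)) (crun pr E c).
Proof.
move=> ur; elim: E c => [|[i j] E IH] c //= /andP[/andP[/= il jl] bE] sc Hpr.
have Hpr' E1 e s : suffix (e :: E1) E -> ~~ pr E1 e s -> size s = size rho ->
     acoef n (map (lift2 rho) E1 ++ E') (glob rho t s) = 0.
  by move=> h; apply: Hpr; apply: suffix_trans h _; exact: suffix_cons.
rewrite -IH ?size_cstep //.
rewrite /cstep cval_cadd /cval !big_map !big_filter.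
set F := fun s => acoef n (map (lift2 rho) E ++ E') (glob rho t s).
have key l : (l < size rho)%N -> (forall p : seq nat * Z, p \in c ->
    ((if nth 0%N p.1 l == 0%N then 0 else F (decs p.1 l)) =
    (if (0 < nth 0%N p.1 l)%N && pr E (i, j) (decs p.1 l) then F (decs p.1 l) else 0))).
  move=> ll p pc; rewrite lt0n; case: eqP => //= _; case: ifP => // /negbT h.
  by rewrite /F (Hpr E (i, j)) ?suffix_refl // size_decs (eqP (allP sc _ pc)).
rewrite [X in _ = X + _]big_mkcond [X in _ = _ + X]big_mkcond -big_split /= big_seq [RHS]big_seq.
apply: eq_bigr => p pc; rewrite /lift2 /= acoef_cons !glob_nth //.
have sp : size p.1 = size rho by apply/eqP/(allP sc).
rewrite !(eq_acoef _ _ (glob_dec _ ur sp _)) // -!/(F _) (key i) // (key j) //.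
rewrite mulrBr; congr (_ + _); first by case: ifP; rewrite ?mulr0.
by case: ifP => _; rewrite ?mulr0 ?oppr0 // -mulNr.
Qed.

Lemma occ_lift rho E i : uniq rho -> (i < size rho)%N -> below (size rho) E ->
  occ (nth 0%N rho i) (map (lift2 rho) E) = occ i E.
Proof.
move=> ur il; elim: E => [|[a b] E IH] //= /andP[/andP[/= al bl] bE].
by rewrite IH // !nth_uniq.
Qed.

Lemma below_suffix m E E' : suffix E' E -> below m E -> below m E'.
Proof. by move=> /suffixP[E1 ->]; rewrite /below all_cat => /andP[]. Qed.

Lemma cval_cfin n c : all (fun p => size p.1 == n) c ->
  cval (fun s => acoef n [::] (glob (iota 0 n) (fun=> 0%N) s)) c = cfin c.
Proof.
elim: c => [|[s z] c IH] /=; first by rewrite /cval big_nil.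
move=> /andP[/eqP sn sc]; rewrite cval_cons IH //= acoef_nil.
have -> : all (fun g => glob (iota 0 n) (fun=> 0%N) s g == 0%N) (iota 0 n)
    = all (eq_op^~ 0%N) s.
  have -> : all (eq_op^~ 0%N) s = all (fun g => nth 0%N s g == 0%N) (iota 0 n).
    by rewrite -{1}(mkseq_nth 0%N s) sn /mkseq all_map; apply: eq_all.
  by apply: eq_in_all => g; rewrite mem_iota => /= gn; rewrite glob_iota.
case: ifP => _; first by rewrite mulr1.
by rewrite mulr0 add0r.
Qed.

Lemma acoef_crun n E s : size s = n -> below n E ->
  acoef n E (nth 0%N s) = cfin (crun occpr E [:: (s, Zpos xH)]).
Proof.
move=> sn bE.
have gs : glob (iota 0 n) (fun=> 0%N) s =1 nth 0%N s.
  move=> g; case: (ltnP g n) => gn; first exact: glob_iota.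
  by rewrite /glob mem_iota /= add0n ltnNge gn /= nth_default ?sn.
have := @crun_ok n (iota 0 n) (fun=> 0%N) E [::] occpr [:: (s, Zpos xH)] (iota_uniq _ _).
rewrite size_iota cats0 /= sn eqxx => /(_ bE isT).
have -> : map (lift2 (iota 0 n)) E = E.
  rewrite -[RHS]map_id; apply/eq_in_map => -[i j] /(allP bE) /= /andP[il jl].
  by rewrite /lift2 /= !nth_iota.
rewrite cval_cfin ?size_crun /= ?sn ?eqxx // => H.
rewrite -(eq_acoef _ _ gs) -H /cval ?big_seq1 /=.
  by rewrite (_ : Zpos xH = 1) // mul1r.
move=> E1 e s' sf; rewrite /occpr negb_and cats0 -!ltnNge => h ss'.
have /andP[/andP[e1 e2] bE1] := below_suffix sf bE.
have ol i : (i < n)%N -> occ i (map (lift2 (iota 0 n)) E1) = occ i E1.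
  move=> il; have e' : i = nth 0%N (iota 0 n) i by rewrite nth_iota.
  by rewrite {1}e' occ_lift ?iota_uniq ?size_iota.
by case/orP: h => h; [apply: (@acoef_occ _ _ _ e.1) | apply: (@acoef_occ _ _ _ e.2)];
  rewrite ?glob_iota ?ol.
Qed.

Definition accept (n : nat) (E : seq (nat * nat)) (s : seq nat) : bool :=
  [&& size s == n, below n E & ~~ Z.eqb (cfin (crun occpr E [:: (s, Zpos xH)])) Z0].

Lemma acceptP n E s : accept n E s -> below n E /\ acoef n E (nth 0%N s) != 0.
Proof.
move=> /and3P[/eqP sn bE nz]; split=> //; rewrite acoef_crun //.
Qed.

Lemma occ_below n E g : below n E -> (n <= g)%N -> occ g E = 0%N.
Proof.
move=> bE ng; elim: E bE => [|[i j] E IH] //= /andP[/andP[/= il jl] bE].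
by rewrite IH // !ltn_eqF // (leq_trans _ ng).
Qed.

Lemma acoef_shrink n m E t : below n E -> (n <= m)%N ->
  (forall g, (n <= g)%N -> t g = 0%N) -> acoef m E t = acoef n E t.
Proof.
move=> bE nm; elim: E t bE => [|[i j] E IH] t /= bE t0.
  rewrite !acoef_nil -(subnKC nm) iotaD all_cat add0n.
  have -> : all (fun g => t g == 0%N) (iota n (m - n)) = true.
    by apply/allP => g; rewrite mem_iota => /andP[ng _]; rewrite t0.
  by rewrite andbT.
case/andP: bE => _ bE; rewrite !acoef_cons !IH // => g ng;
  by rewrite /dec /upd; case: eqP => [<-|_]; rewrite t0.
Qed.

End Expansion.

(** * The coefficient of a long cycle *)

(* The edges of a cycle are grouped in consecutive pairs made of a cycle edge and
   of the pendant edge at its end; a block lists the conflicts of one pair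
   [(a, b)] with itself and with the next two pairs.  Two pairs have positions
   [(0, 1)] and [(2, 3)]; they are preceded by the pairs [(2j + 4, 2j + 5)],
   taken in decreasing order of [j]. *)
Definition wblock (a b a' b' a'' : nat) : seq (nat * nat) :=
  [:: (a, b); (a, a'); (a, b'); (b, a'); (b, b'); (a, a''); (b, a'')].

Fixpoint chain (r : nat) : seq (nat * nat) :=
  if r is r'.+1 then
    wblock r'.*2.+4.+4 r'.*2.+4.+4.+1 r'.*2.+4.+2 r'.*2.+4.+3 r'.*2.+4 ++ chain r'
  else wblock 6 7 4 5 0 ++ wblock 4 5 0 1 2.

Definition sun_pairs (r : nat) : seq (nat * nat) :=
  wblock 0 1 2 3 r.*2.+4.+2 ++ wblock 2 3 r.*2.+4.+2 r.*2.+4.+3 r.*2.+4 ++ chain r.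

(* The list [v] holds the exponents at 0, 1, 2, 3 and at the three positions
   [2r + 4], [2r + 6], [2r + 7] that the block processed last has touched.  The
   other pairs have exponents (5, 2), except for (3, 3) and (5, 3) just before
   the pair [(0, 1)]: with (5, 2) everywhere the coefficient often vanishes. *)
Definition chain_exp (r : nat) (v : seq nat) (g : nat) : nat :=
  if g == r.*2.+4 then nth 0 v 4 else
  if g == r.*2.+4.+2 then nth 0 v 5 else
  if g == r.*2.+4.+3 then nth 0 v 6 else
  if g < 4 then nth 0 v g else
  if g < 8 then nth 0 [:: 5; 3; 3; 3] (g - 4) else
  if r.*2.+4.+4 <= g then 0 else if odd g then 2 else 5.

Definition sun_start : seq nat := [:: 5; 3; 3; 3; 5; 5; 2].

(** Local coordinates 0 to 4 stand for the positions [2r + 4], [2r + 6], [2r + 7], [2r + 8],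
    [2r + 9]. The exponents 5 and 2 belong to [2r + 4] and [2r + 7], which enter with this block.
    Coordinates 3 and 4 occur in no later block, so their exponents must be used up. *)
Definition transfer1 (p : seq nat * Z) : combo :=
  [seq (take 4 p.1 ++ take 3 q.1, Z.mul p.2 q.2) |
    q <- crun nopr (wblock 3 4 1 2 0)
           [:: ([:: 5; nth 0 p.1 4; 2; nth 0 p.1 5; nth 0 p.1 6], Zpos xH)]
    & (nth 0 q.1 3 == 0) && (nth 0 q.1 4 == 0)].

Definition transfer (c : combo) : combo :=
  foldr (fun p => cadd (transfer1 p)) [::] c.

#[global] Arguments transfer1 : simpl never.

(** The two blocks that are not in the chain; local coordinates 4, 5, 6 stand for the positions
    [2r + 4], [2r + 6], [2r + 7]. *)
Definition sun_combo : combo :=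
  crun nopr (wblock 0 1 2 3 5 ++ wblock 2 3 5 6 4) [:: (sun_start, Zpos xH)].

Definition base_coef (v : seq nat) : Z :=
  cfin (crun occpr (chain 2) [:: (mkseq (chain_exp 2 v) 12, Zpos xH)]).

Definition base_val (c : combo) : Z :=
  foldr (fun p z => Z.add (Z.mul p.2 (base_coef p.1)) z) Z0 c.

Ltac if_cases :=
  repeat (let h := fresh "h" in case: ifP => h); try done; try (exfalso; lia).

Section SunCoefficient.
Local Open Scope ring_scope.

Definition chain_coef (r : nat) (v : seq nat) : Z :=
  acoef r.*2.+4.+4 (chain r) (chain_exp r v).

Lemma below_leq m n E : (m <= n)%N -> below m E -> below n E.
Proof.
move=> mn; apply: sub_all => e /andP[e1 e2].
by rewrite !(leq_trans _ mn).
Qed.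

Lemma below_cat n E1 E2 : below n (E1 ++ E2) = below n E1 && below n E2.
Proof. exact: all_cat. Qed.

Lemma below_chain r : below r.*2.+4.+4 (chain r).
Proof.
elim: r => [|r IH] //; rewrite below_cat (below_leq _ IH) ?andbT; last by lia.
by rewrite /below /=; lia.
Qed.

Lemma below_sun_pairs r : below r.*2.+4.+4 (sun_pairs r).
Proof. by rewrite !below_cat below_chain andbT /below /=; lia. Qed.

(** The bound [2 <= r] keeps the entering positions clear of the exceptional exponents at 4 to 7;
    this is why the recursion ends at [chain 2]. *)
Lemma chain_coef_transfer1 r v : (2 <= r)%N -> size v = 7 ->
  chain_coef r.+1 v = cval (chain_coef r) (transfer1 (v, Zpos xH)).
Proof.
case: v => [|v0 [|v1 [|v2 [|v3 [|v4 [|v5 [|v6 [|]]]]]]]] // r2 _.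
set v := [:: v0; v1; v2; v3; v4; v5; v6].
pose rho := [:: r.*2.+4; r.*2.+4.+2; r.*2.+4.+3; r.*2.+4.+4; r.*2.+4.+4.+1]%N.
pose s := [:: 5; v4; 2; v5; v6]%N.
have ur : uniq rho by rewrite /= !inE; lia.
have gl : glob rho (chain_exp r.+1 v) s =1 chain_exp r.+1 v.
  move=> g; rewrite /glob /chain_exp !inE /=.
  if_cases.
have := @crun_ok r.+1.*2.+4.+4 rho (chain_exp r.+1 v) (wblock 3 4 1 2 0) (chain r) nopr
  [:: (s, Zpos xH)] ur isT isT (fun _ _ _ _ h => match notF h with end).
rewrite {1}/cval big_seq1 [p in p.2 * _]/= (_ : Zpos xH = 1) // mul1r.
rewrite /chain_coef -(eq_acoef _ _ gl) => ->.
rewrite /transfer1; set c := crun _ _ _; have : all (fun p => size p.1 == 5) c.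
  exact: size_crun.
elim: c => [|[q z] c IH] /=; first by rewrite /cval !big_nil.
case/andP; case: q => [|q0 [|q1 [|q2 [|q3 [|q4 [|]]]]]] //= _ sc.
rewrite cval_cons IH //=; case: ifP => [/andP[/eqP -> /eqP ->]|q34].
  rewrite cval_cons; congr (_ * _ + _); first by case: (z).
  rewrite (@acoef_shrink r.*2.+4.+4) ?below_chain //; first last.
  - by move=> g gr; rewrite /glob /chain_exp !inE /=; if_cases.
  - by lia.
  apply: eq_acoef => g; rewrite /glob /chain_exp !inE /=; if_cases.
  by case: g h3 {h h0 h1 h2 h4 h5} => [|[|[|[|g]]]].
rewrite (_ : acoef _ _ _ = 0) ?mulr0 ?add0r //.
move/nandP: q34 => [q3n|q4n].
  apply: (@acoef_occ _ _ _ (nth 0%N rho 3)) => /=; first by lia.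
  by rewrite (occ_below (below_chain r)) // -[X in glob _ _ _ X]/(nth 0%N rho 3) glob_nth // lt0n.
apply: (@acoef_occ _ _ _ (nth 0%N rho 4)) => /=; first by lia.
rewrite (occ_below (below_chain r)) //.
by rewrite -[X in glob _ _ _ X]/(nth 0%N rho 4) glob_nth // lt0n.
Qed.
Lemma transfer_cons p c : transfer (p :: c) = cadd (transfer1 p) (transfer c).
Proof. by []. Qed.

Lemma cval_transfer r c : (2 <= r)%N -> all (fun p => size p.1 == 7) c ->
  cval (chain_coef r.+1) c = cval (chain_coef r) (transfer c).
Proof.
move=> r2; elim: c => [|[v z] c IH]; first by rewrite /cval !big_nil.
case/andP=> /eqP sv sc; rewrite transfer_cons cval_cadd cval_cons IH //.
congr (_ + _).
rewrite (chain_coef_transfer1 r2 sv) /cval /transfer1 !big_map mulr_sumr.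
by apply: eq_bigr => q _; rewrite mulrA; congr (_ * _); case: (q.2); case: (z).
Qed.

Lemma size_transfer c : all (fun p => size p.1 == 7) c ->
  all (fun p => size p.1 == 7) (transfer c).
Proof.
elim: c => [|[v z] c IH]; first by [].
move=> /andP[/eqP sv sc]; rewrite transfer_cons; apply: size_cadd; last exact: IH.
rewrite /transfer1 all_map; set d := crun _ _ _.
have sd : all (fun p => size p.1 == 5) d by exact: size_crun.
apply/allP => q; rewrite mem_filter => /andP[_ /(allP sd) /eqP sq].
by rewrite /preim inE size_cat !size_take sv sq.
Qed.

Lemma cval_iter_transfer j c : all (fun p => size p.1 == 7) c ->
  cval (chain_coef (j + 2)) c = cval (chain_coef 2) (iter j transfer c).
Proof.
elim: j c => [|j IH] c sc; first by [].
rewrite addSn cval_transfer ?leq_addl // IH ?size_transfer //.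
by rewrite -iterSr.
Qed.

Lemma chain_coef2 v : chain_coef 2 v = base_coef v.
Proof.
rewrite /base_coef -(acoef_crun (size_mkseq _ _) (isT : below 12 (chain 2))).
apply: eq_acoef => g; case: (ltnP g 12) => g12; first by rewrite nth_mkseq.
by rewrite nth_default ?size_mkseq // /chain_exp; if_cases.
Qed.

Lemma cval_base c : cval (chain_coef 2) c = base_val c.
Proof.
elim: c => [|[v z] c IH]; first by rewrite /cval big_nil.
by rewrite cval_cons IH chain_coef2.
Qed.

Lemma acoef_sun_pairs r : (2 <= r)%N ->
  acoef r.*2.+4.+4 (sun_pairs r) (chain_exp r sun_start) = cval (chain_coef r) sun_combo.
Proof.
move=> r2; pose rho := [:: 0; 1; 2; 3; r.*2.+4; r.*2.+4.+2; r.*2.+4.+3]%N.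
have ur : uniq rho by rewrite /= !inE; lia.
have gl v : size v = 7 -> glob rho (chain_exp r sun_start) v =1 chain_exp r v.
  case: v => [|v0 [|v1 [|v2 [|v3 [|v4 [|v5 [|v6 [|]]]]]]]] // _ g.
  rewrite /glob /chain_exp !inE.
  by case: g => [|[|[|[|g]]]] //=; if_cases.
have := @crun_ok r.*2.+4.+4 rho (chain_exp r sun_start)
  (wblock 0 1 2 3 5 ++ wblock 2 3 5 6 4) (chain r) nopr
  [:: (sun_start, Zpos xH)] ur isT isT (fun _ _ _ _ h => match notF h with end).
rewrite {1}/cval big_seq1 [p in p.2 * _]/= (_ : Zpos xH = 1) // mul1r.
rewrite (eq_acoef _ _ (gl _ _)) // -/sun_combo => E.
apply: etrans E _; rewrite /cval big_seq [RHS]big_seq; apply: eq_bigr => p pc.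
congr (_ * _); apply/eq_acoef/gl/eqP.
have sz : all (fun p => size p.1 == 7) sun_combo by exact: size_crun.
exact: (allP sz _ pc).
Qed.

Lemma iter_period (T : Type) (f : T -> T) x a b j :
  iter a f x = iter b f x -> iter (j + a) f x = iter (j + b) f x.
Proof. by move=> e; rewrite !iterD e. Qed.

Lemma sun_combo_period : iter 10 transfer sun_combo = iter 4 transfer sun_combo.
Proof. by apply/eqP; vm_cast_no_check (erefl true). Qed.

(** Iterates 1 to 9 are computed; from the tenth on, six steps at a time are taken off by
    [sun_combo_period]. *)
Lemma sun_combo_base_neq0 j : base_val (iter j.+1 transfer sun_combo) != 0.
Proof.
have [k] := ubnP j; elim: k j => // k IH j jk.
case: (ltnP j 9) => j9; last first.
  have := IH (j - 6)%N; have -> : j.+1 = (j - 9 + 10)%N by lia.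
  rewrite (iter_period _ sun_combo_period); have -> : (j - 6).+1 = (j - 9 + 4)%N by lia.
  by apply; lia.
have /allP/(_ j) h :
    all (fun i => base_val (iter i.+1 transfer sun_combo) != 0) (iota 0 9).
  by vm_cast_no_check (erefl true).
by apply: h; rewrite mem_iota.
Qed.

(** For a cycle of length [k] one takes [r = k - 4], so the bound on [r] is [7 <= k] and the
    [2r + 8] variables are the [2k] edges meeting the cycle. *)
Theorem acoef_sun_neq0 r : (3 <= r)%N ->
  acoef r.*2.+4.+4 (sun_pairs r) (chain_exp r sun_start) != 0.
Proof.
move=> r3; rewrite acoef_sun_pairs; last by lia.
have -> : r = ((r - 3).+1 + 2)%N by lia.
rewrite cval_iter_transfer; last exact: size_crun.
by rewrite cval_base; apply: sun_combo_base_neq0.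
Qed.

End SunCoefficient.

(** * Extending partial colourings *)

Section Extension.
Variable G : sgraph.
Hypothesis hG : subcubic G.
Implicit Types (x y z c : G) (e f : {set G}) (R T U : {set G}) (D : {set {set G}}).

Definition nbr x : {set G} := [set y | adj x y].

(** On edges this is conflict or equality: a third edge meeting both joins an end of one to an end
    of the other. *)
Definition near e f : bool :=
  [exists x in e, exists y in f, (x == y) || adj x y].

(** An edge linking two edges that avoid [R] has its ends on them and avoids [R] too, so deleting
    [R] does not change their conflicts. *)
Definition free R : {set {set G}} := [set e in edge_set G | [disjoint e & R]].

Lemma nearP e f :
  reflect (exists x y, [/\ x \in e, y \in f & (x == y) || adj x y]) (near e f).
Proof.
apply: (iffP exists_inP) => [[x xe /exists_inP[y yf h]]|[x [y [xe yf h]]]].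
  by exists x, y.
by exists x => //; apply/exists_inP; exists y.
Qed.

Lemma near_sym e f : near e f = near f e.
Proof.
by apply/nearP/nearP => -[x [y [xe yf h]]]; exists y, x; rewrite eq_sym adj_sym.
Qed.

Lemma edge_setP e : reflect (exists x y, adj x y /\ e = [set x; y]) (e \in edge_set G).
Proof.
apply: (iffP imsetP) => [[[x y]]|[x [y [xy ->]]]]; last by exists (x, y).
by rewrite inE /= => xy ->; exists x, y.
Qed.

Lemma edge_set_with e x : e \in edge_set G -> x \in e ->
  exists2 y, adj x y & e = [set x; y].
Proof.
case/edge_setP=> a [b [ab ->]]; rewrite !inE => /orP[] /eqP ->; first by exists b.
by exists a; rewrite 1?adj_sym // setUC.
Qed.

Lemma adj_neq x y : adj x y -> x != y.
Proof. by apply: contraTneq => ->; rewrite adj_irr. Qed.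

Lemma card_nbr x : #|nbr x| <= 3.
Proof. by rewrite cardsE; apply: hG. Qed.

Definition reach x y R : {set G} := (nbr x :|: nbr y) :\: (R :|: [set x; y]).

(** Either [f] shares an end with [xy], and its other end is a new neighbour of that end, or [f]
    contains a neighbour of [x] or [y]. *)
Lemma near_reach x y f R : adj x y -> f \in free R -> f != [set x; y] ->
  near [set x; y] f -> exists2 c, c \in f & c \in reach x y R.
Proof.
rewrite inE => xy /andP[fE dfR] fe /nearP[a [b [axy bf ab]]].
have nR c : c \in f -> c \notin R by move=> cf; rewrite (disjointFr dfR).
have end_ a' b' : [set a'; b'] = [set x; y] -> a' \in f -> exists2 w, w \in f &
    adj a' w && (w \notin [set x; y]).
  move=> ab' af; have [w aw fw] := edge_set_with fE af; exists w.
    by rewrite fw !inE eqxx orbT.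
  rewrite aw -ab' !inE negb_or [w == a']eq_sym adj_neq //=.
  by apply: contraNneq fe => wb; rewrite fw wb ab'.
have [xf|xf] := boolP (x \in f).
  have [w wf /andP[xw wxy]] := end_ x y erefl xf; exists w => //.
  by rewrite /reach in_setD in_setU negb_or nR // wxy in_setU [w \in nbr x]inE xw.
have [yf|yf] := boolP (y \in f).
  have [w wf /andP[yw wxy]] := end_ y x (setUC _ _) yf; exists w => //.
  by rewrite /reach in_setD in_setU negb_or nR // wxy in_setU [w \in nbr y]inE yw orbT.
exists b => //; have nb : b \notin [set x; y].
  by rewrite !inE; apply/norP; split; apply: contraTneq bf => ->.
rewrite /reach in_setD in_setU negb_or nR // nb in_setU !inE /=.
case/orP: ab => [/eqP ab|]; first by rewrite -ab axy in nb.
by move: axy; rewrite !inE => /orP[] /eqP -> ->; rewrite ?orbT.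
Qed.

Definition out R e : {set {set G}} := [set f in free R | (f != e) && near e f].

(** Each conflicting edge is charged to a vertex of [reach] on it; four such vertices of degree
    three give the bound 12. *)
Lemma card_out x y R : adj x y ->
  #|out R [set x; y]| <= \sum_(c in reach x y R) #|nbr c :\: R|.
Proof.
move=> xy.
have sub : out R [set x; y] \subset
    \bigcup_(c in reach x y R) [set [set c; w] | w in nbr c :\: R].
  apply/subsetP => f; rewrite inE => /and3P[fR fe nf].
  have [c cf cr] := near_reach xy fR fe nf; apply/bigcupP; exists c => //.
  move: fR; rewrite inE => /andP[fE dfR].
  have [w cw fw] := edge_set_with fE cf; apply/imsetP; exists w => //.
  by rewrite !inE cw (disjointFr dfR) // fw !inE eqxx orbT.
apply: leq_trans (subset_leq_card sub) _.
apply: (big_rec2 (fun (A : {set {set G}}) k => #|A| <= k)); first by rewrite cards0.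
move=> c k A _ Ak; apply: leq_trans (leq_card_setU _ _) _.
by apply: leq_add => //; apply: leq_imset_card.
Qed.

Section Colorings.
Variable L : {set G} -> seq nat.
Hypothesis hL : forall e, uniq (L e) /\ 10 <= size (L e).

Definition colorable D := exists2 psi : {set G} -> nat,
  forall e, e \in D -> psi e \in L e &
  forall e f, e \in D -> f \in D -> e != f -> near e f -> psi e != psi f.

(** Of ten colours at most [9 - t i] are forbidden, so more than [t i] remain, as the
    Nullstellensatz requires. *)
Lemma colorable_extend n (es : nat -> {set G}) E t D (A : {set {set G}}) :
  below n E -> acoef n E t != 0%R ->
  (forall e, e \in A -> exists2 i, i < n & e = es i) ->
  (forall i, i < n -> t i + #|[set f in D | near (es i) f]| <= 9) ->
  (forall i j, i < n -> j < n -> es i != es j -> near (es i) (es j) ->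
     ((i, j) \in E) || ((j, i) \in E)) ->
  colorable D -> colorable (D :|: A).
Proof.
move=> bE nz cov bnd conf [psi psiL psiC].
pose forb i := [seq psi f | f <- enum [set f in D | near (es i) f]].
pose M i := [seq k <- L (es i) | k \notin forb i].
have [i ilt|x xM xC] := acoef_choosable (L := M) bE nz.
  have [uL sL] := hL (es i); split; first exact: filter_uniq.
  have sf : size (forb i) = #|[set f in D | near (es i) f]|.
    by rewrite size_map -cardE.
  have := bnd i ilt; rewrite -sf => b9.
  have : count (mem (forb i)) (L (es i)) <= size (forb i).
    rewrite -size_filter; apply: uniq_leq_size; first exact: filter_uniq.
    by move=> k; rewrite mem_filter => /andP[].
  have := count_predC (mem (forb i)) (L (es i)).
  rewrite /M size_filter.
  have -> : count (fun k => k \notin forb i) (L (es i)) =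
     count (predC (mem (forb i))) (L (es i)) by apply: eq_count.
  move: b9 sL; move: (count _ _) (count _ _) (size _) (size _) => a b l s; lia.
(* The list [es] may repeat an edge; its first index decides the colour. *)
pose ix e := find (fun i => es i == e) (iota 0 n).
have ixP e : e \in A -> ix e < n /\ es (ix e) = e.
  move=> /cov[i ilt ee]; have hs : has (fun i => es i == e) (iota 0 n).
    by apply/hasP; exists i; rewrite ?mem_iota // ee.
  have h := hs; rewrite has_find size_iota in h; split=> //.
  by have /eqP := nth_find 0 hs; rewrite nth_iota.
exists (fun e => if e \in A then x (ix e) else psi e) => [e|e f].
  case: ifP => [/ixP[ilt ee] _|eA]; last by rewrite inE eA orbF => /psiL.
  by have := xM _ ilt; rewrite /M mem_filter ee => /andP[].
have mix e' f' : e' \in A -> f' \in D -> near e' f' -> x (ix e') != psi f'.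
  move=> /ixP[ilt ee] fD nf; have := xM _ ilt; rewrite mem_filter => /andP[h _].
  apply: contraNneq h => ->; apply/map_f.
  by rewrite mem_enum inE fD ee.
rewrite !inE; case: ifP => eA; case: ifP => fA /=; rewrite ?orbF.
- move=> _ _ ef nf; have [il ee] := ixP _ eA; have [jl ff] := ixP _ fA.
  have := conf (ix e) (ix f) il jl; rewrite ee ff => /(_ ef nf) /orP[]/xC //.
  by rewrite eq_sym.
- by move=> _ fD _; apply: mix.
- by move=> eD _ _ nf; rewrite eq_sym; apply: mix; rewrite // near_sym.
- exact: psiC.
Qed.

Lemma colorable_greedy D (A : {set {set G}}) :
  (forall e, e \in A -> #|[set f in D :|: A | (f != e) && near e f]| <= 9) ->
  colorable D -> colorable (D :|: A).
Proof.
have [k] := ubnP #|A|; elim: k A => // k IH A Ak bnd cD.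
have [->|[e eA]] := set_0Vmem A; first by rewrite setU0.
have cA : colorable (D :|: A :\ e).
  apply: IH => //; first by move: Ak; rewrite (cardsD1 e) eA; lia.
  move=> f; rewrite !inE => /andP[_ /bnd]; apply: leq_trans.
  apply: subset_leq_card; apply/subsetP => g; rewrite !inE.
  by move=> /andP[/orP[->|/andP[_ ->]] ->]; rewrite ?orbT.
have -> : D :|: A = (D :|: A :\ e) :|: [set e].
  by rewrite -setUA setUC [A :\ e :|: _]setUC setD1K // setUC.
have [eD|eD] := boolP (e \in D).
  by rewrite (setUidPl _) // sub1set !inE eD.
(* For a single edge the product is empty, with coefficient 1 at exponent 0. *)
apply: (@colorable_extend 1 (fun=> e) [::] (fun=> 0)) => //.
- by move=> f; rewrite inE => /eqP ->; exists 0.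
- move=> i _; apply: leq_trans (bnd e eA); apply: subset_leq_card.
  apply/subsetP => f; rewrite !inE => /andP[/orP[fD|/andP[fe fA]] ->].
    by rewrite fD andbT; apply: contraNneq eD => <-.
  by rewrite fe fA orbT.
- by move=> i j _ _; rewrite eqxx.
Qed.

Lemma freeU1 T x : free T = free (x |: T) :|: [set e in free T | x \in e].
Proof.
apply/setP => e; rewrite !inE; case: (e \in edge_set G) => //=.
rewrite -!setI_eq0 setIUr setU_eq0.
have -> : (e :&: [set x] == set0) = (x \notin e) by rewrite setI_eq0 disjoint_sym disjoints1.
by case: (x \in e); case: (_ == _).
Qed.

(** An edge [xy] reaches at most one further vertex through [x] and two through [y], each on at most
    three edges: nine conflicts. *)
Lemma colorable_vertex T x : x \notin T -> #|nbr x :\: T| <= 2 ->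
  colorable (free (x |: T)) -> colorable (free T).
Proof.
move=> xT dx; rewrite [free T](freeU1 T x) => cx; apply: colorable_greedy => // e.
rewrite -freeU1 inE => /andP[eT xe].
have /andP[eE deT] : (e \in edge_set G) && [disjoint e & T] by rewrite inE in eT.
have [y xy ee] := edge_set_with eE xe.
have yT : y \notin T by rewrite (disjointFr deT) // ee !inE eqxx orbT.
rewrite -/(out T e) ee; apply: leq_trans (card_out T xy) _.
have r3 : #|reach x y T| <= 3.
  have sub : reach x y T \subset ((nbr x :\: T) :\ y) :|: (nbr y :\ x).
    apply/subsetP => c; rewrite !inE !negb_or => /andP[/and3P[-> -> ->]].
    by case/orP=> ->; rewrite ?orbT.
  apply: leq_trans (subset_leq_card sub) _.
  apply: leq_trans (leq_card_setU _ _) _.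
  have := cardsD1 y (nbr x :\: T); have := cardsD1 x (nbr y); have := card_nbr y.
  by rewrite !inE yT xy adj_sym xy /=; lia.
apply: leq_trans (_ : \sum_(c in reach x y T) 3 <= _).
  by apply: leq_sum => c _; apply: leq_trans (card_nbr c); apply/subset_leq_card/subsetDl.
by rewrite sum_nat_const; lia.
Qed.

End Colorings.
End Extension.

(** * Local models and certificates *)

(* The numbers below [msize] name distinct vertices of a graph.  All neighbours of
   the vertices in [mfull] are named; the pairs in [mnon] are not adjacent. *)
Record model := Model {
  msize : nat;
  medges : seq (nat * nat);
  mfull : seq nat;
  mnon : seq (nat * nat)
}.

Section ModelOps.
Variable g : nat.
Implicit Type m : model.

Definition madj m i j := ((i, j) \in medges m) || ((j, i) \in medges m).

Definition mnbr m i := [seq j <- iota 0 (msize m) | madj m i j].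

(* Conditionals instead of [||] and [&&], whose arguments [vm_compute] evaluates
   eagerly. *)
Fixpoint mpath m d vis x w : bool :=
  if x == w then true else if d is d'.+1 then
    has (fun y => if y \in vis then false else mpath m d' (y :: vis) y w) (mnbr m x)
  else false.

(* Reasons why two names that are not linked in the model cannot be adjacent. *)
Definition mapart m v w : bool :=
  if [|| v == w, v \in mfull m, w \in mfull m, (v, w) \in mnon m | (w, v) \in mnon m]
  then true
  else if (3 <= size (mnbr m v)) || (3 <= size (mnbr m w)) then true
  else mpath m (g - 2) [:: v] v w.

Definition mlink m u w :=
  Model (msize m) ((u, w) :: medges m) (mfull m) (mnon m).

Definition munlink m u w :=
  Model (msize m) (medges m) (mfull m) ((u, w) :: mnon m).

(** The new names denote new vertices only if every old name is known to be linked to [v] or apart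
    from it; [certified] checks this. *)
Definition mgrow m v :=
  let k := 3 - size (mnbr m v) in
  Model (msize m + k) ([seq (v, i) | i <- iota (msize m) k] ++ medges m)
    (rcons (mfull m) v) (mnon m).

Definition mroots m : seq (nat * nat) :=
  flatten [seq [seq (i, j) | j <- mnbr m i & (j \notin mfull m) || (i < j)] | i <- mfull m].

Definition mconflict m (p q : nat * nat) : bool :=
  has (fun x => has (fun y => if (x == y) || madj m x y then true else ~~ mapart m x y)
    [:: q.1; q.2]) [:: p.1; p.2].

Definition mconflicts m : seq (nat * nat) :=
  let es := mroots m in let N := size es in
  flatten [seq [seq (a, b) | b <- iota a.+1 (N - a.+1) &
    mconflict m (nth (0, 0) es a) (nth (0, 0) es b)] | a <- iota 0 N].

Definition mouter m (p : nat * nat) : seq nat :=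
  [seq c <- iota 0 (msize m) | (madj m p.1 c || madj m p.2 c) &&
     [&& c != p.1, c != p.2 & c \notin mfull m]].

Definition munnamed m u : nat :=
  if u \in mfull m then 0 else 3 - size (mnbr m u).

(** Follows [card_out]: a named vertex loses one edge for each grown neighbour, an unnamed one
    counts with all three. *)
Definition mout m (p : nat * nat) : nat :=
  sumn [seq 3 - count (mem (mfull m)) (mnbr m c) | c <- mouter m p]
  + 3 * (munnamed m p.1 + munnamed m p.2).

(* [Dec u w] branches on the adjacency of two names, [Grow v] names the missing
   neighbours of [v], and [Leaf t] colours the edges at the grown vertices by
   the monomial with exponents [t]. *)
Inductive cert :=
| Dec of nat & nat & cert & cert
| Grow of nat & cert
| Leaf of seq nat.

Fixpoint certified m (c : cert) : bool :=
  match c with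
  | Dec u w c1 c2 =>
    [&& u < msize m, w < msize m,
        if ~~ madj m u w && mapart m u w then true else certified (mlink m u w) c1
      & certified (munlink m u w) c2]
  | Grow v c' =>
    [&& v < msize m,
        all (fun w => madj m v w || mapart m v w) (iota 0 (msize m))
      & certified (mgrow m v) c']
  | Leaf t =>
    let es := mroots m in
    [&& 0 < size (mfull m),
        all (fun a => nth 0 t a + mout m (nth (0, 0) es a) <= 9) (iota 0 (size es))
      & accept (size es) (mconflicts m) t]
  end.

End ModelOps.

(** * Certificates for shortest cycles of length 3 to 6 *)

Definition mcycle g : model :=
  Model g [seq (i, i.+1 %% g) | i <- iota 0 g] [::] [::].

(** In every case six edges meet the triangle and they conflict pairwise: the product is a
    Vandermonde determinant up to sign, and the staircase exponents pick its diagonal monomial. *)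
Definition cert3 : cert := Grow 0 (Dec 1 3 (Grow 1 (Dec 2 3 (Grow 2 (Leaf [:: 5; 4; 3;
  2; 1; 0])) (Grow 2 (Leaf [:: 5; 4; 3; 2; 1; 0])))) (Grow 1 (Dec 2 3 (Grow 2 (Leaf
  [:: 5; 4; 3; 2; 1; 0])) (Dec 2 4 (Grow 2 (Leaf [:: 5; 4; 3; 2; 1; 0])) (Grow 2 (Leaf
  [:: 5; 4; 3; 2; 1; 0])))))).

(** The grown set must sometimes exceed the cycle. If 0 and 2 share the third neighbour 4, and the
    third neighbours 5 of 1 and 6 of 3 are adjacent, the eight edges at the cycle conflict pairwise,
    but none is guaranteed more than seven colours. *)
Definition cert4 : cert := Grow 0 (Grow 1 (Dec 2 4 (Grow 2 (Dec 3 5 (Grow 3 (Leaf [::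
  7; 6; 5; 4; 3; 2; 1; 0])) (Grow 3 (Dec 5 6 (Dec 4 5 (Grow 4 (Leaf [:: 8; 7; 6; 5; 4;
  3; 2; 1; 0])) (Dec 4 6 (Grow 4 (Leaf [:: 7; 8; 6; 5; 4; 3; 2; 1; 0])) (Grow 4 (Dec 5
  7 (Leaf [:: 6; 2; 5; 7; 1; 3; 4; 4; 3]) (Dec 6 7 (Grow 6 (Leaf [:: 6; 0; 7; 7; 2; 8;
  3; 6; 4; 4; 3])) (Grow 5 (Dec 7 8 (Leaf [:: 9; 7; 4; 7; 3; 2; 6; 2; 0; 3; 3]) (Leaf
  [:: 8; 8; 4; 5; 3; 6; 7; 2; 0; 2; 0])))))))) (Leaf [:: 6; 5; 4; 3; 3; 2; 1; 3])))))
  (Grow 2 (Dec 3 5 (Grow 3 (Dec 4 6 (Dec 5 4 (Grow 5 (Leaf [:: 8; 7; 6; 5; 4; 3; 2; 1;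
  0])) (Dec 5 6 (Grow 5 (Leaf [:: 7; 6; 5; 8; 4; 3; 2; 1; 0])) (Grow 5 (Dec 4 7 (Grow
  4 (Leaf [:: 8; 9; 2; 0; 5; 6; 4; 7; 3; 3; 3])) (Dec 6 7 (Grow 6 (Leaf [:: 8; 7; 4;
  6; 5; 3; 4; 7; 2; 2; 2])) (Leaf [:: 4; 6; 4; 3; 5; 2; 0; 7; 3])))))) (Leaf [:: 6; 5;
  3; 3; 2; 1; 3; 4]))) (Grow 3 (Dec 4 6 (Dec 5 7 (Dec 4 5 (Grow 4 (Dec 6 7 (Grow 6
  (Leaf [:: 5; 8; 5; 7; 2; 4; 4; 6; 4; 3; 5])) (Grow 6 (Dec 7 8 (Leaf [:: 7; 0; 6; 8;
  3; 4; 2; 6; 5; 6; 3]) (Leaf [:: 8; 6; 6; 4; 7; 6; 3; 2; 5; 2; 0]))))) (Dec 4 7 (Grow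
  4 (Dec 6 5 (Grow 6 (Leaf [:: 8; 8; 3; 2; 7; 2; 6; 5; 1; 6; 5])) (Grow 6 (Dec 5 8
  (Leaf [:: 1; 8; 7; 3; 4; 8; 4; 4; 4; 7; 0]) (Leaf [:: 6; 3; 3; 5; 4; 7; 4; 5; 6; 4;
  2]))))) (Grow 4 (Dec 6 5 (Grow 6 (Dec 7 8 (Leaf [:: 7; 6; 4; 7; 5; 0; 5; 6; 5; 0;
  5]) (Leaf [:: 8; 6; 4; 7; 4; 0; 7; 3; 3; 3; 4]))) (Dec 6 7 (Grow 6 (Dec 5 8 (Leaf
  [:: 5; 7; 5; 5; 0; 8; 8; 2; 2; 2; 6]) (Leaf [:: 6; 1; 4; 5; 5; 4; 8; 6; 5; 0; 5])))
  (Grow 6 (Dec 5 8 (Dec 7 9 (Leaf [:: 6; 0; 6; 7; 3; 6; 3; 4; 4; 4; 4]) (Leaf [:: 5;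
  6; 7; 3; 5; 7; 5; 0; 4; 2; 2])) (Dec 5 9 (Dec 7 8 (Leaf [:: 6; 0; 6; 7; 3; 6; 3; 4;
  4; 4; 4]) (Leaf [:: 6; 7; 6; 6; 5; 4; 4; 0; 5; 2; 1])) (Dec 7 8 (Leaf [:: 7; 4; 4;
  5; 3; 7; 7; 0; 5; 3; 1]) (Dec 7 9 (Leaf [:: 7; 1; 6; 7; 0; 4; 4; 5; 5; 3; 4]) (Leaf
  [:: 7; 5; 4; 7; 0; 4; 7; 4; 4; 2; 1]))))))))))) (Dec 4 5 (Grow 4 (Dec 6 7 (Grow 6
  (Leaf [:: 7; 1; 8; 7; 3; 8; 5; 4; 2; 3; 2])) (Grow 6 (Dec 5 8 (Dec 7 8 (Leaf [:: 5;
  6; 7; 8; 3; 5; 5; 0; 4; 0; 6]) (Leaf [:: 7; 0; 6; 8; 3; 3; 4; 3; 6; 5; 3])) (Dec 7 8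
  (Leaf [:: 8; 7; 6; 7; 2; 5; 5; 1; 6; 1; 0]) (Leaf [:: 7; 3; 8; 5; 4; 7; 6; 1; 4; 1;
  1])))))) (Dec 4 7 (Grow 4 (Dec 6 5 (Grow 6 (Leaf [:: 8; 7; 4; 5; 3; 1; 7; 2; 2; 5;
  6])) (Grow 6 (Dec 5 8 (Dec 7 8 (Leaf [:: 0; 5; 6; 6; 4; 8; 4; 6; 1; 3; 6]) (Leaf [::
  5; 7; 8; 6; 3; 2; 5; 5; 3; 2; 2])) (Dec 7 8 (Leaf [:: 5; 7; 8; 3; 1; 7; 3; 4; 2; 5;
  3]) (Leaf [:: 3; 7; 7; 4; 0; 8; 6; 1; 4; 5; 2])))))) (Grow 4 (Dec 6 5 (Grow 6 (Dec 5
  8 (Dec 7 8 (Leaf [:: 6; 4; 7; 7; 4; 3; 8; 0; 1; 4; 5]) (Leaf [:: 8; 7; 7; 7; 4; 3;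
  6; 0; 1; 2; 3])) (Dec 7 8 (Leaf [:: 7; 6; 6; 8; 1; 3; 8; 2; 2; 2; 3]) (Leaf [:: 5;
  6; 6; 8; 5; 6; 4; 1; 1; 0; 5])))) (Dec 6 7 (Grow 6 (Dec 5 8 (Dec 7 8 (Leaf [:: 7; 8;
  4; 6; 0; 1; 7; 5; 2; 6; 3]) (Leaf [:: 4; 8; 5; 5; 0; 8; 7; 1; 3; 2; 5])) (Dec 7 8
  (Leaf [:: 6; 7; 1; 5; 0; 8; 6; 4; 2; 3; 6]) (Leaf [:: 4; 4; 6; 5; 1; 7; 5; 6; 2; 1;
  6])))) (Grow 6 (Dec 5 8 (Dec 5 9 (Dec 7 8 (Dec 7 9 (Leaf [:: 6; 7; 6; 6; 3; 2; 5; 5;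
  2; 4; 2]) (Leaf [:: 1; 7; 7; 5; 3; 7; 5; 1; 5; 5; 1])) (Dec 7 9 (Leaf [:: 5; 4; 4;
  5; 4; 7; 7; 2; 5; 0; 4]) (Leaf [:: 5; 7; 5; 7; 4; 6; 4; 0; 5; 3; 0]))) (Dec 7 8 (Dec
  7 9 (Leaf [:: 7; 0; 5; 5; 3; 7; 7; 2; 4; 5; 2]) (Leaf [:: 7; 0; 6; 7; 3; 5; 5; 4; 4;
  5; 0])) (Dec 7 9 (Leaf [:: 6; 7; 6; 6; 4; 4; 4; 0; 5; 3; 1]) (Leaf [:: 5; 6; 5; 7;
  1; 3; 7; 0; 5; 4; 2])))) (Dec 5 9 (Dec 7 8 (Dec 7 9 (Leaf [:: 6; 5; 5; 7; 0; 3; 7;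
  4; 5; 1; 4]) (Leaf [:: 6; 7; 6; 6; 4; 4; 4; 0; 5; 3; 1])) (Dec 7 9 (Leaf [:: 6; 1;
  6; 7; 0; 5; 4; 4; 5; 3; 5]) (Leaf [:: 7; 6; 5; 5; 4; 7; 4; 0; 3; 2; 2]))) (Dec 7 8
  (Dec 7 9 (Leaf [:: 6; 1; 6; 7; 0; 5; 4; 5; 4; 4; 4]) (Leaf [:: 5; 6; 5; 7; 0; 3; 7;
  1; 5; 4; 2])) (Dec 7 9 (Leaf [:: 1; 6; 5; 7; 0; 6; 6; 3; 5; 3; 3]) (Leaf [:: 7; 1;
  6; 7; 0; 5; 4; 3; 5; 3; 3])))))))))))) (Dec 5 7 (Dec 5 4 (Grow 5 (Dec 7 6 (Grow 7
  (Leaf [:: 8; 7; 2; 6; 8; 7; 2; 5; 1; 2; 2])) (Grow 7 (Dec 4 8 (Dec 6 8 (Leaf [:: 8;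
  8; 4; 6; 5; 5; 1; 3; 7; 1; 1]) (Leaf [:: 7; 8; 5; 5; 5; 3; 1; 3; 5; 3; 3])) (Dec 6 8
  (Leaf [:: 7; 8; 4; 4; 6; 5; 1; 3; 4; 2; 4]) (Leaf [:: 5; 7; 5; 7; 4; 5; 3; 3; 4; 1;
  3])))))) (Dec 5 6 (Grow 5 (Dec 7 4 (Grow 7 (Leaf [:: 7; 8; 4; 8; 3; 0; 5; 5; 3; 6;
  1])) (Grow 7 (Dec 4 8 (Dec 6 8 (Leaf [:: 7; 3; 0; 5; 5; 7; 7; 2; 7; 3; 3]) (Leaf [::
  7; 6; 1; 6; 5; 2; 6; 3; 3; 5; 4])) (Dec 6 8 (Leaf [:: 3; 0; 3; 8; 5; 7; 6; 4; 7; 2;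
  3]) (Leaf [:: 3; 3; 1; 8; 4; 7; 5; 6; 6; 2; 2])))))) (Grow 5 (Dec 7 4 (Grow 7 (Dec 4
  8 (Dec 6 8 (Leaf [:: 7; 8; 5; 7; 3; 0; 3; 5; 3; 5; 3]) (Leaf [:: 8; 8; 5; 5; 5; 3;
  0; 4; 2; 3; 5])) (Dec 6 8 (Leaf [:: 7; 8; 5; 7; 3; 1; 3; 5; 4; 3; 2]) (Leaf [:: 7;
  8; 5; 7; 1; 5; 3; 5; 3; 2; 1])))) (Dec 7 6 (Grow 7 (Dec 4 8 (Dec 6 8 (Leaf [:: 5; 5;
  1; 8; 0; 7; 5; 5; 2; 4; 7]) (Leaf [:: 4; 6; 1; 4; 5; 8; 0; 6; 5; 4; 5])) (Dec 6 8
  (Leaf [:: 3; 2; 2; 6; 5; 7; 4; 8; 1; 3; 7]) (Leaf [:: 6; 5; 2; 6; 3; 8; 5; 5; 2; 2;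
  3])))) (Grow 7 (Dec 4 8 (Dec 4 9 (Dec 6 8 (Dec 6 9 (Leaf [:: 6; 7; 5; 7; 3; 2; 4; 5;
  3; 5; 1]) (Leaf [:: 6; 6; 0; 5; 4; 7; 3; 5; 3; 5; 3])) (Dec 6 9 (Leaf [:: 7; 7; 2;
  6; 4; 5; 2; 5; 5; 0; 4]) (Leaf [:: 6; 1; 5; 7; 5; 7; 3; 6; 3; 3; 0]))) (Dec 6 8 (Dec
  6 9 (Leaf [:: 7; 7; 4; 5; 2; 6; 4; 4; 2; 2; 4]) (Leaf [:: 6; 7; 3; 7; 4; 3; 4; 5; 3;
  4; 0])) (Dec 6 9 (Leaf [:: 7; 7; 1; 6; 6; 1; 3; 5; 3; 4; 3]) (Leaf [:: 6; 7; 4; 7;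
  3; 3; 3; 5; 3; 4; 0])))) (Dec 4 9 (Dec 6 8 (Dec 6 9 (Leaf [:: 7; 7; 1; 6; 4; 5; 3;
  5; 5; 0; 4]) (Leaf [:: 7; 7; 1; 6; 6; 1; 3; 5; 3; 4; 3])) (Dec 6 9 (Leaf [:: 7; 7;
  1; 3; 6; 6; 4; 4; 4; 0; 4]) (Leaf [:: 6; 7; 4; 7; 3; 4; 3; 5; 3; 3; 0]))) (Dec 6 8
  (Dec 6 9 (Leaf [:: 7; 7; 0; 5; 5; 4; 4; 3; 3; 4; 4]) (Leaf [:: 7; 7; 0; 4; 6; 6; 4;
  4; 5; 0; 2])) (Dec 6 9 (Leaf [:: 6; 6; 0; 5; 4; 7; 3; 5; 3; 3; 3]) (Leaf [:: 6; 7;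
  0; 4; 6; 3; 1; 7; 5; 2; 3]))))))))))) (Leaf [:: 5; 2; 3; 4; 3; 3; 3; 3])))))))).

(** Third neighbours 5 to 9 are distinct, and by the girth only those of cycle vertices at distance
    two can be adjacent: five decisions. *)
Definition cert5 : cert := Grow 0 (Grow 1 (Grow 2 (Grow 3 (Grow 4 (Dec 5 7 (Dec 5 8
  (Dec 6 8 (Dec 6 9 (Dec 7 9 (Leaf [:: 5; 5; 5; 5; 2; 1; 4; 4; 4; 5]) (Leaf [:: 5; 5;
  4; 5; 5; 3; 2; 5; 4; 1])) (Dec 7 9 (Leaf [:: 5; 5; 5; 5; 0; 2; 5; 4; 4; 4]) (Leaf
  [:: 3; 4; 4; 5; 4; 5; 3; 5; 5; 0]))) (Dec 6 9 (Dec 7 9 (Leaf [:: 5; 5; 5; 5; 0; 2;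
  5; 4; 3; 5]) (Leaf [:: 5; 5; 5; 4; 3; 5; 1; 3; 4; 3])) (Dec 7 9 (Leaf [:: 5; 5; 4;
  5; 0; 5; 4; 4; 4; 2]) (Leaf [:: 5; 5; 4; 5; 0; 5; 4; 4; 4; 1])))) (Dec 6 8 (Dec 6 9
  (Dec 7 9 (Leaf [:: 5; 5; 4; 5; 1; 2; 5; 4; 3; 5]) (Leaf [:: 5; 4; 0; 5; 5; 5; 3; 4;
  4; 3])) (Dec 7 9 (Leaf [:: 4; 5; 4; 5; 0; 4; 5; 4; 3; 4]) (Leaf [:: 5; 5; 3; 4; 4;
  5; 3; 4; 4; 0]))) (Dec 6 9 (Dec 7 9 (Leaf [:: 4; 5; 4; 5; 0; 4; 5; 4; 2; 5]) (Leaf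
  [:: 5; 5; 4; 4; 4; 5; 2; 3; 3; 2])) (Dec 7 9 (Leaf [:: 5; 5; 3; 5; 0; 5; 5; 4; 3;
  2]) (Leaf [:: 5; 5; 3; 4; 0; 5; 4; 4; 3; 3]))))) (Dec 5 8 (Dec 6 8 (Dec 6 9 (Dec 7 9
  (Leaf [:: 5; 5; 4; 5; 1; 2; 4; 4; 4; 5]) (Leaf [:: 5; 5; 4; 4; 4; 5; 0; 3; 5; 3]))
  (Dec 7 9 (Leaf [:: 4; 5; 4; 5; 0; 4; 4; 4; 4; 4]) (Leaf [:: 5; 5; 4; 4; 3; 5; 0; 3;
  5; 3]))) (Dec 6 9 (Dec 7 9 (Leaf [:: 4; 5; 4; 5; 0; 4; 4; 4; 3; 5]) (Leaf [:: 5; 5;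
  4; 4; 3; 5; 0; 3; 4; 4])) (Dec 7 9 (Leaf [:: 5; 5; 4; 5; 0; 4; 4; 3; 3; 4]) (Leaf
  [:: 5; 5; 4; 5; 0; 4; 3; 4; 3; 3])))) (Dec 6 8 (Dec 6 9 (Dec 7 9 (Leaf [:: 5; 5; 0;
  5; 5; 4; 4; 3; 2; 5]) (Leaf [:: 4; 4; 0; 5; 5; 4; 3; 4; 4; 4])) (Dec 7 9 (Leaf [::
  4; 4; 0; 5; 4; 4; 4; 4; 4; 4]) (Leaf [:: 5; 5; 3; 5; 1; 5; 2; 4; 4; 2]))) (Dec 6 9
  (Dec 7 9 (Leaf [:: 5; 5; 3; 5; 1; 4; 4; 3; 2; 5]) (Leaf [:: 5; 5; 3; 4; 4; 5; 0; 4;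
  3; 3])) (Dec 7 9 (Leaf [:: 5; 5; 3; 5; 0; 5; 3; 4; 3; 3]) (Leaf [:: 5; 5; 3; 5; 2;
  5; 3; 4; 0; 3])))))))))).

(** By the girth only third neighbours of opposite cycle vertices can be adjacent: three
    decisions. *)
Definition cert6 : cert := Grow 0 (Grow 1 (Grow 2 (Grow 3 (Grow 4 (Grow 5 (Dec 6 9
  (Dec 7 10 (Dec 8 11 (Leaf [:: 5; 5; 4; 5; 3; 1; 3; 5; 4; 5; 2; 3]) (Leaf [:: 5; 5;
  4; 5; 3; 4; 3; 5; 3; 4; 3; 0])) (Dec 8 11 (Leaf [:: 5; 5; 4; 5; 0; 5; 3; 4; 4; 3; 3;
  3]) (Leaf [:: 5; 5; 4; 4; 3; 5; 0; 4; 4; 4; 2; 3]))) (Dec 7 10 (Dec 8 11 (Leaf [::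
  5; 5; 3; 5; 3; 4; 4; 5; 2; 4; 3; 1]) (Leaf [:: 5; 5; 3; 4; 4; 5; 0; 4; 3; 4; 3; 3]))
  (Dec 8 11 (Leaf [:: 5; 5; 3; 4; 3; 5; 1; 4; 3; 4; 2; 4]) (Leaf [:: 5; 5; 3; 5; 0; 5;
  3; 4; 3; 5; 3; 1]))))))))).

Lemma leq_sum_subseq (I : finType) (B : {set I}) (s : seq I) (F : I -> nat) :
  {subset B <= s} -> \sum_(c in B) F c <= \sum_(c <- s) F c.
Proof.
elim: s B => [|a s IH] B sub.
  by rewrite big1 // => c /sub; rewrite in_nil.
have h : \sum_(c in B :\ a) F c <= \sum_(c <- s) F c.
  by apply: IH => c; rewrite !inE => /andP[ca /sub]; rewrite inE (negbTE ca).
rewrite big_cons; have [aB|aB] := boolP (a \in B).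
  by rewrite (big_setD1 a) //= leq_add2l.
have e : B :\ a = B.
  by apply/setDidPl; rewrite disjoint_sym disjoints1.
by rewrite e in h; apply: leq_trans h (leq_addl _ _).
Qed.

(** * Soundness of the certificates *)

Section Configurations.
Variable G : sgraph.
Hypothesis hG : subcubic G.
Variable L : {set G} -> seq nat.
Hypothesis hL : forall e, uniq (L e) /\ 10 <= size (L e).
Variable T : {set G}.
Hypothesis cubic : forall x : G, x \notin T -> #|nbr x :\: T| = 3.
Hypothesis IHT : forall T' : {set G}, T \proper T' -> colorable L (free T').

(** Three neighbours outside [T] exhaust the degree, so no edge joins [T] to its complement. *)
Lemma nbr_notin (x y : G) : x \notin T -> adj x y -> y \notin T.
Proof.
move=> xT xy; have := cardsID T (nbr x); rewrite cubic // => h.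
have := card_nbr hG x; rewrite -h => h'; have /eqP : #|nbr x :&: T| = 0 by lia.
rewrite cards_eq0 => /eqP /setP /(_ y); rewrite !inE xy /=.
by move=> ->.
Qed.

Lemma card_nbr3 (x : G) : x \notin T -> #|nbr x| = 3.
Proof.
move=> xT; rewrite -(cubic xT); apply: eq_card => y; rewrite !inE.
by case xy: (adj x y); rewrite ?andbF // (nbr_notin xT xy).
Qed.

Lemma colorable_configuration n (es : nat -> {set G}) E t (S : {set G}) :
  S != set0 -> [disjoint S & T] ->
  below n E -> acoef n E t != 0%R ->
  (forall i, i < n -> ~~ [disjoint es i & S]) ->
  (forall e, e \in free T -> ~~ [disjoint e & S] -> exists2 i, i < n & e = es i) ->
  (forall i, i < n -> t i + #|out (T :|: S) (es i)| <= 9) ->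
  (forall i j, i < n -> j < n -> es i != es j -> near (es i) (es j) ->
     ((i, j) \in E) || ((j, i) \in E)) ->
  colorable L (free T).
Proof.
move=> S0 dST bE nz meet cov bnd conf.
have -> : free T = free (T :|: S) :|: [set e in free T | ~~ [disjoint e & S]].
  apply/setP => e; rewrite !inE; case: (e \in edge_set G) => //=.
  rewrite -!setI_eq0 setIUr setU_eq0.
  by case: (e :&: T == set0); case: (e :&: S == set0).
apply: (colorable_extend hL (es := es) bE nz) => //; first last.
- apply: IHT; apply/properP; split; first exact: subsetUl.
  have [x xS] := set0Pn _ S0; exists x; first by rewrite inE xS orbT.
  by rewrite (disjointFr dST).
(* [out] leaves out [es i] itself, but this edge meets [S] and so is not among the coloured ones. *)
- move=> i ilt; apply: leq_trans (bnd i ilt); rewrite leq_add2l.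
  apply: subset_leq_card; apply/subsetP => f; rewrite !inE => /andP[/andP[-> df] ->].
  rewrite df /= andbT; apply: contraNneq (meet i ilt) => <-.
  by apply: disjointWr df; apply: subsetUr.
- by move=> e; rewrite inE => /andP[]; apply: cov.
Qed.

Section Models.
Variable g : nat.
Hypothesis girth : forall p : seq G, 2 < size p < g -> all (fun x => x \notin T) p ->
  uniq p -> ~~ cycle (@adj G) p.

Record realizes (m : model) (phi : nat -> G) : Prop := Realizes {
  realizes_inj : forall i j, i < msize m -> j < msize m -> phi i = phi j -> i = j;
  realizes_out : forall i, i < msize m -> phi i \notin T;
  realizes_edge : forall i j, (i, j) \in medges m ->
    [/\ i < msize m, j < msize m & adj (phi i) (phi j)];
  realizes_full : forall i, i \in mfull m -> i < msize m /\
    forall y, adj (phi i) y -> exists2 j, madj m i j & y = phi j;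
  realizes_non : forall i j, (i, j) \in mnon m ->
    [/\ i < msize m, j < msize m & ~~ adj (phi i) (phi j)]
}.

Section Realization.
Variables (m : model) (phi : nat -> G).
Hypothesis mphi : realizes m phi.

Lemma madjP i j : madj m i j -> [/\ i < msize m, j < msize m & adj (phi i) (phi j)].
Proof.
case/orP=> /(realizes_edge mphi)[a b ab]; first by split.
by split; rewrite // adj_sym.
Qed.

Lemma madj_sym i j : madj m i j = madj m j i.
Proof. exact: orbC. Qed.

Lemma mem_mnbr i j : (j \in mnbr m i) = madj m i j.
Proof.
rewrite mem_filter mem_iota add0n /=.
by case ij: (madj m i j) => //=; have [] := madjP ij.
Qed.

Lemma uniq_mnbr i : uniq (mnbr m i).
Proof. by rewrite filter_uniq ?iota_uniq. Qed.

Lemma uniq_map_phi s : uniq s -> all (fun i => i < msize m) s -> uniq (map phi s).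
Proof.
move=> us /allP hs; rewrite map_inj_in_uniq // => i j /hs hi /hs hj.
exact: (realizes_inj mphi).
Qed.

Lemma size_leq_nbr x (s : seq G) : uniq s -> all (adj x) s -> size s <= #|nbr x|.
Proof.
move=> us /allP hs; rewrite -(card_uniqP us); apply: subset_leq_card.
by apply/subsetP => y /hs xy; rewrite inE.
Qed.

Lemma mpathP d vis x w : mpath m d vis x w -> exists p,
  [/\ path (madj m) x p, last x p = w, size p <= d, uniq p
    & all (fun y => y \notin vis) p].
Proof.
elim: d vis x => [|d IH] vis x /=; case: eqP => [->|_] //; try by exists [::].
case/hasP=> y; rewrite mem_mnbr; case: ifP => // yv xy /IH[p [yp lp sp up vp]].
exists (y :: p); split; rewrite //= ?xy ?ltnS ?yv ?up ?andbT //=.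
  by apply/negP => /(allP vp); rewrite inE eqxx.
by apply: sub_all vp => z; rewrite inE negb_or => /andP[].
Qed.

Lemma size_mnbr_apart v w : v < msize m -> w < msize m -> ~~ madj m v w ->
  3 <= size (mnbr m v) -> ~~ adj (phi v) (phi w).
Proof.
move=> vm wm nvw s3; apply/negP => vw.
have : size (map phi (w :: mnbr m v)) <= #|nbr (phi v)|.
  apply: size_leq_nbr.
    apply: uniq_map_phi => /=; first by rewrite mem_mnbr nvw uniq_mnbr.
    by rewrite wm; apply/allP => j; rewrite mem_mnbr => /madjP[].
  rewrite /= vw all_map; apply/allP => j; rewrite mem_mnbr => /madjP[_ _ h].
  exact: h.
by rewrite size_map /= => h; have := leq_trans h (card_nbr hG (phi v)); rewrite ltnS leqNgt s3.
Qed.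

Lemma mapartP v w : v < msize m -> w < msize m -> ~~ madj m v w ->
  mapart g m v w -> ~~ adj (phi v) (phi w).
Proof.
move=> vm wm nvw; rewrite /mapart; case: ifP => [h _|vw0].
  have nfull a b : a < msize m -> b < msize m -> ~~ madj m a b -> a \in mfull m ->
      ~~ adj (phi a) (phi b).
    move=> am bm nab af; apply/negP => ab.
    have [_ /(_ _ ab) [j aj bj]] := realizes_full mphi af.
    have [_ jm _] := madjP aj.
    by rewrite (realizes_inj mphi bm jm bj) aj in nab.
  case/or4P: h => [/eqP ->|vf|wf|/orP[] h].
  - by rewrite adj_irr.
  - exact: nfull.
  - by rewrite adj_sym; apply: nfull; rewrite // madj_sym.
  - by have [] := realizes_non mphi h.
  - by rewrite adj_sym; have [] := realizes_non mphi h.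
case: ifP => [/orP[] s3 _|_].
- exact: size_mnbr_apart.
- by rewrite adj_sym; apply: size_mnbr_apart; rewrite // madj_sym.
(* A simple path with at most [g - 2] edges, closed by the edge [vw], would be a cycle shorter than
   [g]. *)
case/mpathP=> p [vp lp sp up pv]; apply/negP => vw.
have pm : all (fun i => i < msize m) (v :: p).
  rewrite /= vm /=; elim: p v vp {lp sp up pv nvw vw vw0 vm} => [|a p IH] v //=.
  by case/andP=> /madjP[_ -> _] /IH.
have uvp : uniq (v :: p).
  by rewrite /= up andbT; apply/negP => /(allP pv); rewrite inE eqxx.
have := girth (p := map phi (v :: p)); rewrite size_map.
have sz : 2 < size (v :: p) < g.
  have s2 : 2 <= size p.
    case: p vp lp {sp up pv pm uvp} => [|a [|b p]] //=.
      by move=> _ wv; rewrite wv eqxx in vw0.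
    by rewrite andbT => va aw; rewrite aw in va; rewrite va in nvw.
  by move: sp s2 => /=; move: (size p) => k; lia.
move=> /(_ sz); rewrite (uniq_map_phi uvp pm).
have -> : all (fun x => x \notin T) (map phi (v :: p)).
  by rewrite all_map; apply: sub_all pm => i; apply: (realizes_out mphi).
move=> /(_ isT isT) /negP; apply; rewrite /= rcons_path last_map lp adj_sym vw andbT.
rewrite path_map; apply: sub_path vp => i j /madjP[_ _]; exact.
Qed.

Lemma madj_of_adj i j : i < msize m -> j < msize m -> adj (phi i) (phi j) ->
  madj m i j || ~~ mapart g m i j.
Proof.
move=> im jm ij; case mij: (madj m i j) => //=.
by apply/negP => /(mapartP im jm (negbT mij)); rewrite ij.
Qed.

Definition mset : {set G} := [set x in map phi (mfull m)].

Lemma mem_mset i : i < msize m -> (phi i \in mset) = (i \in mfull m).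
Proof.
move=> im; rewrite inE; apply/mapP/idP => [[j jf ij]|jf]; last by exists i.
have [jm _] := realizes_full mphi jf.
by rewrite (realizes_inj mphi im jm ij).
Qed.

Lemma mem_mroots i j : (i, j) \in mroots m ->
  [/\ i \in mfull m, madj m i j & (j \notin mfull m) || (i < j)].
Proof.
case/flattenP=> s /mapP[a af ->] /mapP[b]; rewrite mem_filter => /andP[h].
by rewrite mem_mnbr => ab [-> ->].
Qed.

Lemma mrootsI i j : i \in mfull m -> madj m i j -> (j \notin mfull m) || (i < j) ->
  (i, j) \in mroots m.
Proof.
move=> imf ij h; apply/flattenP.
exists [seq (i, j) | j <- mnbr m i & (j \notin mfull m) || (i < j)].
  exact: (map_f (fun i => [seq (i, j) | j <- mnbr m i & (j \notin mfull m) || (i < j)])).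
by apply: map_f; rewrite mem_filter h mem_mnbr.
Qed.

Definition rootset (p : nat * nat) : {set G} := [set phi p.1; phi p.2].

Lemma near_mconflict p q : p \in mroots m -> q \in mroots m ->
  near (rootset p) (rootset q) -> mconflict g m p q.
Proof.
case: p => p1 p2 /mem_mroots[_ /madjP[p1m p2m _] _].
case: q => q1 q2 /mem_mroots[_ /madjP[q1m q2m _] _] /nearP[x [y [xe yf h]]].
rewrite /rootset /= in xe yf.
have [i ip ix] : exists2 i, i \in [:: p1; p2] & x = phi i.
  by move: xe; rewrite !inE => /orP[] /eqP ->; [exists p1|exists p2]; rewrite ?inE ?eqxx ?orbT.
have [j jq jy] : exists2 j, j \in [:: q1; q2] & y = phi j.
  by move: yf; rewrite !inE => /orP[] /eqP ->; [exists q1|exists q2]; rewrite ?inE ?eqxx ?orbT.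
have im : i < msize m by move: ip; rewrite !inE => /orP[] /eqP ->.
have jm : j < msize m by move: jq; rewrite !inE => /orP[] /eqP ->.
apply/hasP; exists i => //; apply/hasP; exists j => //.
case: ifP => // /norP[ij nij].
case/orP: h => [/eqP xy|xy].
  by rewrite (realizes_inj mphi im jm) ?eqxx // in ij; rewrite -ix -jy.
by have := madj_of_adj im jm; rewrite -ix -jy => /(_ xy); rewrite (negbTE nij).
Qed.

Lemma mconflictsI a b : a < b -> b < size (mroots m) ->
  mconflict g m (nth (0, 0) (mroots m) a) (nth (0, 0) (mroots m) b) ->
  (a, b) \in mconflicts g m.
Proof.
move=> ab bs h; rewrite /mconflicts.
set N := size _; set F := fun a => [seq (a, b) | b <- iota a.+1 (N - a.+1) &
    mconflict g m (nth (0, 0) (mroots m) a) (nth (0, 0) (mroots m) b)].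
apply/flattenP; exists (F a); first by apply: map_f; rewrite mem_iota add0n (ltn_trans ab).
by apply: map_f; rewrite mem_filter h mem_iota ab subnKC // (ltn_trans ab).
Qed.

Lemma card_nbr_mset c : c < msize m ->
  #|nbr (phi c) :\: (T :|: mset)| <= 3 - count (mem (mfull m)) (mnbr m c).
Proof.
move=> cm; set s := [seq j <- mnbr m c | j \in mfull m].
have us : uniq (map phi s).
  apply: uniq_map_phi; first by rewrite filter_uniq ?uniq_mnbr.
  by apply/allP => j; rewrite mem_filter mem_mnbr => /andP[_ /madjP[]].
have -> : count (mem (mfull m)) (mnbr m c) = #|map phi s|.
  by rewrite (card_uniqP us) size_map size_filter.
have h : #|nbr (phi c) :&: mset| >= #|map phi s|.
  apply: subset_leq_card; apply/subsetP => y /mapP[j]; rewrite mem_filter mem_mnbr.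
  move=> /andP[jf cj] ->; have [_ jm a] := madjP cj.
  by rewrite in_setI mem_mset // jf inE a.
have : #|nbr (phi c) :\: (T :|: mset)| <= #|nbr (phi c) :\: mset|.
  by apply: subset_leq_card; apply/setDS/subsetUr.
by have := cardsID mset (nbr (phi c)); have := card_nbr hG (phi c); lia.
Qed.

Definition unnamed u : seq G :=
  if u \in mfull m then [::]
  else enum (nbr (phi u) :\: [set x in map phi (mnbr m u)]).

Lemma size_unnamed u : u < msize m -> size (unnamed u) <= munnamed m u.
Proof.
rewrite /unnamed /munnamed => um; case: ifP => // _; rewrite -cardE.
have us : uniq (map phi (mnbr m u)).
  apply: uniq_map_phi; first exact: uniq_mnbr.
  by apply/allP => j; rewrite mem_mnbr => /madjP[].
have := cardsID [set x in map phi (mnbr m u)] (nbr (phi u)).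
have -> : nbr (phi u) :&: [set x in map phi (mnbr m u)] = [set x in map phi (mnbr m u)].
  apply/setIidPr/subsetP => y; rewrite inE => /mapP[j]; rewrite mem_mnbr => /madjP[_ _ a] ->.
  by rewrite inE.
rewrite cardsE (card_uniqP us) size_map.
by have := card_nbr hG (phi u); move: (size _) => s h3 h; rewrite leq_subRL; lia.
Qed.

Lemma named_or_unnamed u y : u < msize m -> adj (phi u) y ->
  (exists2 j, madj m u j & y = phi j) \/ y \in unnamed u.
Proof.
move=> um uy; rewrite /unnamed; case: ifP => [uf|_].
  by left; have [_ /(_ _ uy)] := realizes_full mphi uf.
rewrite mem_enum inE [y \in nbr _]inE uy andbT inE.
case: (boolP (y \in _)) => [/mapP[j]|_]; last by right.
by rewrite mem_mnbr => uj ->; left; exists j.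
Qed.

Lemma card_out_rootset p : p \in mroots m ->
  #|out (T :|: mset) (rootset p)| <= mout m p.
Proof.
case: p => u w /mem_mroots[uf uw _]; have [um wm auw] := madjP uw.
apply: leq_trans (card_out _ auw) _.
set F := fun c => #|nbr c :\: (T :|: mset)|.
have F3 c : F c <= 3.
  by apply: leq_trans (card_nbr hG c); apply/subset_leq_card/subsetDl.
apply: leq_trans (leq_sum_subseq (s := map phi (mouter m (u, w)) ++
    (unnamed u ++ unnamed w)) F _) _.
  move=> c /setDP[h]; rewrite in_setU negb_or in_setU negb_or.
  move=> /andP[/andP[_ cS] cuw].
  rewrite mem_cat mem_cat.
  have key v : (v == u) || (v == w) -> adj (phi v) c ->
      (c \in map phi (mouter m (u, w))) || (c \in unnamed v).
    move=> vuw vc; have vm : v < msize m by case/orP: vuw => /eqP ->.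
    have [[j vj cj]|->] := named_or_unnamed vm vc; last by rewrite orbT.
    have [_ jm _] := madjP vj; apply/orP; left; apply/mapP; exists j => //.
    rewrite mem_filter mem_iota add0n jm andbT /= -mem_mset // -cj cS andbT.
    move: cuw; rewrite cj in_set2 negb_or => /andP[cu cw].
    rewrite (contraNneq _ cu) ?(contraNneq _ cw); try by move=> ->.
    by case/orP: vuw => /eqP <-; rewrite vj ?orbT.
  rewrite !inE in h; case/orP: h => h.
    by have := key u; rewrite eqxx => /(_ isT h) /orP[] ->; rewrite ?orbT.
  by have := key w; rewrite eqxx orbT => /(_ isT h) /orP[] ->; rewrite ?orbT.
rewrite !big_cat /= /mout; apply: leq_add.
  rewrite big_map sumnE big_map [X in X <= _]big_seq [X in _ <= X]big_seq; apply: leq_sum => c.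
  rewrite mem_filter mem_iota add0n => /andP[_ /= cm]; exact: card_nbr_mset.
have sum3 (s : seq G) k : size s <= k -> \sum_(c <- s) F c <= 3 * k.
  move=> sk; apply: leq_trans (_ : \sum_(c <- s) 3 <= _); first exact: leq_sum.
  by rewrite big_const_seq iter_addn_0 count_predT; lia.
by rewrite mulnDr; apply: leq_add; apply: sum3; apply: size_unnamed.
Qed.

Lemma leaf_sound t : certified g m (Leaf t) -> colorable L (free T).
Proof.
move=> /and3P[full0 /allP bnd acc]; have [bE nz] := acceptP acc.
set N := size (mroots m) in bnd bE nz acc *.
have memr a : a < N -> nth (0, 0) (mroots m) a \in mroots m by apply: mem_nth.
apply: (@colorable_configuration N (fun a => rootset (nth (0, 0) (mroots m) a))
  (mconflicts g m) (nth 0 t) mset) => //.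
- case e: (mfull m) full0 => [|i s] // _.
  by apply/set0Pn; exists (phi i); rewrite /mset e !inE eqxx.
- apply/pred0P => x /=; apply/negP => /andP[]; rewrite inE => /mapP[i imf ->].
  by apply/negP/(realizes_out mphi); have [] := realizes_full mphi imf.
- move=> a /memr; case: (nth _ _ _) => i j /mem_mroots[imf _ _].
  apply/pred0Pn; exists (phi i); rewrite /= !inE eqxx /=; exact: map_f.
- move=> e; rewrite inE => /andP[eE _] /pred0Pn[x /=]; rewrite inE => /andP[xe].
  case/mapP=> i imf xi; have [im full_i] := realizes_full mphi imf.
  have [y xy ey] := edge_set_with eE xe; rewrite xi in xy ey.
  have [j ij yj] := full_i _ xy; have [_ jm _] := madjP ij.
  have ij_ne : i != j by apply: contraTneq xy => ij'; rewrite yj ij' adj_irr.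
  have [h|/norP[jf]] := boolP ((j \notin mfull m) || (i < j)).
    exists (index (i, j) (mroots m)); first by rewrite index_mem mrootsI.
    by rewrite nth_index ?mrootsI // ey yj.
  rewrite negbK in jf; rewrite -leqNgt leq_eqVlt eq_sym (negbTE ij_ne) /= => ji.
  have mem_ji : (j, i) \in mroots m by apply: mrootsI; rewrite ?ji ?orbT // madj_sym.
  exists (index (j, i) (mroots m)); first by rewrite index_mem.
  by rewrite nth_index // ey yj /rootset setUC.
- move=> a aN; apply: leq_trans (bnd a _); last by rewrite mem_iota.
  by rewrite leq_add2l card_out_rootset ?memr.
- move=> a b aN bN ab nab; case: (ltngtP a b) => [lt|lt|eq].
  + by rewrite mconflictsI // near_mconflict ?memr.
  + by rewrite [X in _ || X]mconflictsI ?orbT // near_mconflict ?memr // near_sym.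
  + by rewrite eq eqxx in ab.
Qed.

Lemma grow_realizes v : v < msize m ->
  all (fun w => madj m v w || mapart g m v w) (iota 0 (msize m)) ->
  exists phi', realizes (mgrow m v) phi'.
Proof.
move=> vm /allP hv; set k := 3 - size (mnbr m v).
pose ys := enum (nbr (phi v) :\: [set x in map phi (mnbr m v)]).
have us : uniq (map phi (mnbr m v)).
  apply: uniq_map_phi; first exact: uniq_mnbr.
  by apply/allP => j; rewrite mem_mnbr => /madjP[].
have sy : size ys = k.
  rewrite -cardE /k -(card_nbr3 (realizes_out mphi vm)) cardsD.
  congr (_ - _); rewrite -(size_map phi) -(card_uniqP us) -[RHS]cardsE.
  apply: eq_card => y; rewrite !inE andbC; case: mapP => //= -[j]; rewrite mem_mnbr.
  by case/madjP=> _ _ a ->.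
(* A new neighbour cannot carry an old name: by [hv] such a name would be linked to [v], hence
   already listed, or apart from it. *)
have ysP y : y \in ys -> adj (phi v) y /\ forall i, i < msize m -> y != phi i.
  rewrite mem_enum => /setDP[]; rewrite [y \in nbr _]inE => vy ny; split=> // i im.
  apply: contraNneq ny => yi; rewrite yi in vy *; rewrite inE map_f // mem_mnbr.
  have := hv i; rewrite mem_iota add0n => /(_ im); case mvi: (madj m v i) => //=.
  by move/(mapartP vm im (negbT mvi)); rewrite vy.
pose phi' i := if i < msize m then phi i else nth (phi v) ys (i - msize m).
have old i : i < msize m -> phi' i = phi i by rewrite /phi' => ->.
have new i : msize m <= i < msize m + k -> phi' i \in ys.
  by case/andP=> h1 h2; rewrite /phi' ltnNge h1 /=; apply: mem_nth; rewrite sy; lia.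
exists phi'; split=> /=; rewrite -/k.
- move=> i j ik jk; case: (ltnP i (msize m)) => im; case: (ltnP j (msize m)) => jm.
  + by rewrite !old //; apply: (realizes_inj mphi).
  + rewrite old // => e; have jj : msize m <= j < msize m + k by rewrite jm.
    by have [_ /(_ _ im)] := ysP _ (new j jj); rewrite e eqxx.
  + rewrite [phi' j]old // => e; have ii : msize m <= i < msize m + k by rewrite im.
    by have [_ /(_ _ jm)] := ysP _ (new i ii); rewrite e eqxx.
  + rewrite /phi' !ltnNge im jm /= => /eqP; rewrite nth_uniq ?enum_uniq ?sy; lia.
- move=> i ik; case: (ltnP i (msize m)) => im; first by rewrite old ?(realizes_out mphi).
  have ii : msize m <= i < msize m + k by rewrite im.
  have [vi _] := ysP _ (new i ii); exact: nbr_notin (realizes_out mphi vm) vi.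
- move=> i j; rewrite mem_cat => /orP[/mapP[b]|/(realizes_edge mphi)[im jm ij]].
    rewrite mem_iota => hb [-> ->]; rewrite old //; have [vi _] := ysP _ (new b hb).
    by split=> //; lia.
  by rewrite !old //; split=> //; lia.
- move=> i; rewrite mem_rcons inE => /orP[/eqP ->|imf].
    split=> [|y]; first by lia.
    rewrite old // => vy; have [yin|yin] := boolP (y \in map phi (mnbr m v)).
      case/mapP: yin => j; rewrite mem_mnbr => vj ->; have [_ jm _] := madjP vj.
      by exists j; rewrite ?old // /madj /= !mem_cat; case/orP: vj => ->; rewrite ?orbT.
    have yy : y \in ys by rewrite mem_enum !inE yin vy.
    exists (msize m + index y ys).
      apply/orP; left; rewrite mem_cat; apply/orP; left; apply/map_f.
      by rewrite mem_iota leq_addr ltn_add2l -/k -sy index_mem.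
    by rewrite /phi' ltnNge leq_addr /= addKn nth_index.
  have [im full_i] := realizes_full mphi imf; split=> [|y]; first by lia.
  rewrite old // => /full_i [j ij yj]; have [_ jm _] := madjP ij.
  by exists j; rewrite ?old // /madj /= !mem_cat; case/orP: ij => ->; rewrite ?orbT.
- move=> i j /(realizes_non mphi)[im jm ij]; rewrite !old //; split=> //; lia.
Qed.

End Realization.

Lemma certified_sound c m phi :
  realizes m phi -> certified g m c -> colorable L (free T).
Proof.
elim: c m phi => [u w c1 IH1 c2 IH2|v c IH|t] m phi mphi.
- case/and4P=> um wm h1 h2.
  have [uw|uw] := boolP (adj (phi u) (phi w)); last first.
    apply: (IH2 _ phi) h2; case: mphi => inj out edge full non; split=> //= i j.
    by rewrite inE => /orP[/eqP[-> ->]|/non].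
  move: h1; case: ifP => [/andP[nuw /(mapartP mphi um wm nuw)]|_ h1]; first by rewrite uw.
  apply: (IH1 _ phi) h1; case: mphi => inj out edge full non; split=> //= [i j|i /full[im h]].
    by rewrite inE => /orP[/eqP[-> ->]|/edge].
  split=> // y /h[j ij yj]; exists j => //.
  by rewrite /madj /= !inE; case/orP: ij => ->; rewrite ?orbT.
- case/and3P=> vm hv h; have [phi' mphi'] := grow_realizes mphi vm hv.
  exact: IH mphi' h.
- exact: (leaf_sound mphi).
Qed.

End Models.
End Configurations.

(** * Long shortest cycles *)

Section Indexing.
Variable k : nat.

Definition nx i := if i.+1 == k then 0 else i.+1.
Definition pv i := if i == 0 then k.-1 else i.-1.

(** Chosen so that [sun_pairs] runs through the blocks in cyclic order [k - 2], [k - 1], 0, ...,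
    [k - 3]. The pairs [k - 2] and [k - 1], where the cycle closes, get the fixed positions 0 to
    3. *)
Definition pair_pos i := if i < k - 2 then (k - 3 - i).*2.+4 else (i - (k - 2)).*2.
Definition pair_of g := if g < 4 then k - 2 + g./2 else k - 3 - (g - 4)./2.

Lemma nx_lt i : i < k -> nx i < k.
Proof. by rewrite /nx; case: eqP; lia. Qed.

Lemma nxP i : i < k -> (i.+1 = k /\ nx i = 0) \/ (i.+1 < k /\ nx i = i.+1).
Proof. by rewrite /nx; case: eqP; lia. Qed.

Lemma pv_lt i : i < k -> pv i < k.
Proof. by rewrite /pv; case: eqP; lia. Qed.

Lemma nx_pv i : i < k -> nx (pv i) = i.
Proof. by move=> ik; rewrite /pv; case: eqP => i0; rewrite /nx; case: eqP; lia. Qed.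

Lemma pv_nx i : i < k -> pv (nx i) = i.
Proof. by move=> ik; rewrite /nx; case: eqP => i0; rewrite /pv; case: eqP; lia. Qed.

Hypothesis k7 : 7 <= k.

Lemma pair_of_lt g : g < k.*2 -> pair_of g < k.
Proof. by rewrite /pair_of; case: ifP; lia. Qed.

Lemma pair_posK g : g < k.*2 -> g = pair_pos (pair_of g) + odd g.
Proof. by rewrite /pair_pos /pair_of; case: (ltnP g 4) => ?; case: ifP; lia. Qed.

Lemma pair_pos_lt i (b : bool) : i < k -> pair_pos i + b < k.*2.
Proof. by rewrite /pair_pos; case: ifP; case: b; lia. Qed.

Lemma pair_ofK i (b : bool) : i < k -> pair_of (pair_pos i + b) = i.
Proof.
rewrite /pair_pos /pair_of => ik; case: (ltnP i (k - 2)) => ik2.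
  have -> : ((k - 3 - i).*2.+4 + b < 4) = false by lia.
  by case: b; lia.
have -> : (i - (k - 2)).*2 + b < 4 by case: b; lia.
by case: b; lia.
Qed.

Lemma odd_pair_pos i (b : bool) : odd (pair_pos i + b) = b.
Proof. by rewrite /pair_pos oddD; case: ifP => _; rewrite /= ?negbK odd_double oddb. Qed.

Definition pair_block i := wblock (pair_pos i) (pair_pos i).+1
  (pair_pos (nx i)) (pair_pos (nx i)).+1 (pair_pos (nx (nx i))).

Lemma sub_chain r j : 2 <= j <= r.+1 ->
  {subset wblock j.*2.+4 j.*2.+4.+1 j.-1.*2.+4 j.-1.*2.+4.+1 j.-2.*2.+4 <= chain r}.
Proof.
elim: r => [|r IH] jr p; first by lia.
rewrite mem_cat; have [e|ne] := eqVneq j r.+2.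
  by rewrite e /= => ->.
by move=> h; apply/orP; right; apply: IH h; lia.
Qed.

Lemma sub_chain01 r :
  {subset wblock 6 7 4 5 0 ++ wblock 4 5 0 1 2 <= chain r}.
Proof. by elim: r => [|r IH] p h //; rewrite mem_cat IH ?orbT. Qed.

(** The blocks of the last four pairs involve the closing positions 0 to 3 and are treated singly;
    all others come from the uniform recursion of [chain]. *)
Lemma sub_sun_pairs i : i < k -> {subset pair_block i <= sun_pairs (k - 4)}.
Proof.
move=> ik p; rewrite /pair_block /sun_pairs !mem_cat => h.
have [e|n1] := eqVneq i (k - 2).
  move: h; rewrite e /nx /pair_pos; case: eqP => [|_]; first by lia.
  case: eqP => [_|]; last by lia.
  case: ifP => [|_]; first by lia.
  case: ifP => [|_]; first by lia.
  case: ifP => [_|]; last by lia.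
  have -> : (k - 2 - (k - 2)).*2 = 0 by lia.
  have -> : ((k - 2).+1 - (k - 2)).*2 = 2 by lia.
  have -> : (k - 3 - 0).*2.+4 = (k - 4).*2.+4.+2 by lia.
  by move=> ->.
have [e|n2] := eqVneq i (k - 1).
  move: h; rewrite e /nx /pair_pos; case: eqP => [_|]; last by lia.
  case: eqP => [|_]; first by lia.
  case: ifP => [|_]; first by lia.
  case: ifP => [_|]; last by lia.
  case: ifP => [_|]; last by lia.
  have -> : (k - 1 - (k - 2)).*2 = 2 by lia.
  have -> : (k - 3 - 0).*2.+4 = (k - 4).*2.+4.+2 by lia.
  have -> : (k - 3 - 1).*2.+4 = (k - 4).*2.+4 by lia.
  by move=> ->; rewrite orbT.
apply/orP; right; apply/orP; right.
have [e|n3] := eqVneq i (k - 3).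
  apply: sub_chain01; rewrite mem_cat; apply/orP; right.
  move: h; rewrite e /nx /pair_pos; case: eqP => [|_]; first by lia.
  case: eqP => [|_]; first by lia.
  case: ifP => [_|]; last by lia.
  case: ifP => [|_]; first by lia.
  case: ifP => [|_]; first by lia.
  have -> : (k - 3 - (k - 3)).*2.+4 = 4 by lia.
  have -> : ((k - 3).+1 - (k - 2)).*2 = 0 by lia.
  by have -> : ((k - 3).+2 - (k - 2)).*2 = 2 by lia.
have [e|n4] := eqVneq i (k - 4).
  apply: sub_chain01; rewrite mem_cat; apply/orP; left.
  move: h; rewrite e /nx /pair_pos; case: eqP => [|_]; first by lia.
  case: eqP => [|_]; first by lia.
  case: ifP => [_|]; last by lia.
  case: ifP => [_|]; last by lia.
  case: ifP => [|_]; first by lia.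
  have -> : (k - 3 - (k - 4)).*2.+4 = 6 by lia.
  have -> : (k - 3 - (k - 4).+1).*2.+4 = 4 by lia.
  by have -> : ((k - 4).+2 - (k - 2)).*2 = 0 by lia.
have := @sub_chain (k - 4) (k - 3 - i) _ p; apply; first by lia.
move: h; rewrite /nx /pair_pos; case: eqP => [|_]; first by lia.
case: eqP => [|_]; first by lia.
case: ifP => [_|]; last by lia.
case: ifP => [_|]; last by lia.
case: ifP => [_|]; last by lia.
have -> : k - 3 - i.+1 = (k - 3 - i).-1 by lia.
by have -> : k - 3 - i.+2 = (k - 3 - i).-2 by lia.
Qed.

Definition paired g h := ((g, h) \in sun_pairs (k - 4)) || ((h, g) \in sun_pairs (k - 4)).

Lemma paired_sym g h : paired g h = paired h g.
Proof. exact: orbC. Qed.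

Lemma pairedW i g h : i < k -> (g, h) \in pair_block i -> paired g h.
Proof. by move=> ik gh; rewrite /paired (sub_sun_pairs ik). Qed.

(** The caps 5 and 3 complete the bounds of [out_rim] and [out_spoke] to 9. *)
Lemma chain_exp_le g : chain_exp (k - 4) sun_start g <= if odd g then 3 else 5.
Proof.
rewrite /chain_exp /=; case: eqP => [->|_]; first by rewrite /= !negbK odd_double.
case: eqP => [->|_]; first by rewrite /= !negbK odd_double.
case: eqP => [->|_]; first by rewrite /= !negbK odd_double.
case: ltnP => g4; first by case: g g4 => [|[|[|[|]]]].
case: ltnP => g8; first by case: g g4 g8 => [|[|[|[|[|[|[|[|]]]]]]]].
by case: ifP => // _; case: ifP.
Qed.

End Indexing.

Lemma cycle_nth (S : Type) (e : rel S) (x0 : S) (q : seq S) i :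
  cycle e q -> i < size q -> e (nth x0 q i) (nth x0 q (nx (size q) i)).
Proof.
case: q => [|x s] //= /(pathP x0) h i_s; have := h i; rewrite size_rcons => /(_ i_s).
rewrite -rcons_cons nth_rcons /= i_s nth_rcons /nx eqSS.
by case: (ltngtP i (size s)) => //; rewrite ltnS in i_s; move: i_s; case: ltngtP.
Qed.

Section LongCycles.
Variable G : sgraph.
Hypothesis hG : subcubic G.
Variable L : {set G} -> seq nat.
Hypothesis hL : forall e, uniq (L e) /\ 10 <= size (L e).
Variable T : {set G}.
Hypothesis cubic : forall x : G, x \notin T -> #|nbr x :\: T| = 3.
Hypothesis IHT : forall T' : {set G}, T \proper T' -> colorable L (free T').
Variables (x0 : G) (p : seq G).
Hypothesis up : uniq p.
Hypothesis cp : cycle (@adj G) p.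
Hypothesis pT : all (fun x => x \notin T) p.
Hypothesis girth : forall q : seq G, 2 < size q < size p ->
  all (fun x => x \notin T) q -> uniq q -> ~~ cycle (@adj G) q.
Hypothesis k7 : 7 <= size p.

Let k := size p.
Let v i := nth x0 p i.

Lemma v_inj i j : i < k -> j < k -> v i = v j -> i = j.
Proof. by move=> ik jk /eqP; rewrite nth_uniq // => /eqP. Qed.

Lemma v_mem i : i < k -> v i \in p.
Proof. exact: mem_nth. Qed.

Lemma v_out i : i < k -> v i \notin T.
Proof. by move=> ik; apply: (allP pT); apply: v_mem. Qed.

Lemma v_adj i : i < k -> adj (v i) (v (nx k i)).
Proof. exact: cycle_nth. Qed.

Lemma v_adj_pv i : i < k -> adj (v i) (v (pv k i)).
Proof.
by move=> ik; rewrite adj_sym -{2}(nx_pv ik); apply: v_adj; apply: pv_lt.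
Qed.

(** An arc closed by a path [w] off the cycle is again a cycle, so it is not shorter. Rotating to
    start at [i] turns every arc into an initial segment. *)
Lemma arc_leq i d w : i < k -> d < k -> uniq w -> all (fun y => y \notin T) w ->
  all (fun y => y \notin p) w ->
  path (@adj G) (nth x0 (rot i p) d) (rcons w (nth x0 (rot i p) 0)) ->
  2 < d.+1 + size w -> k <= d.+1 + size w.
Proof.
move=> ik dk uw wT wp pth s2; rewrite leqNgt; apply/negP => lt.
have sq : size (rot i p) = k by rewrite size_rot.
have uq : uniq (rot i p) by rewrite rot_uniq.
have cq : cycle (@adj G) (rot i p) by rewrite rot_cycle.
have mq : rot i p =i p by move=> y; rewrite mem_rot.
move: (rot i p) sq uq cq mq pth => q sq uq cq mq pth.
have szt : size (take d.+1 q) = d.+1 by rewrite size_takel // sq.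
have := girth (q := take d.+1 q ++ w); rewrite size_cat szt s2 lt => /(_ isT).
have -> : all (fun x => x \notin T) (take d.+1 q ++ w).
  by rewrite all_cat wT andbT; apply/allP => y /mem_take; rewrite mq => /(allP pT).
have -> : uniq (take d.+1 q ++ w).
  rewrite cat_uniq take_uniq // uw andbT /=; apply/hasPn => y /(allP wp).
  by apply: contra => /mem_take; rewrite mq.
move=> /(_ isT isT) /negP; apply.
case: q sq uq cq mq pth szt => [|x s] /= sq uq cq mq pth szt; first by rewrite -sq in ik.
rewrite rcons_cat cat_path; move: cq; rewrite rcons_path => /andP[xs _].
rewrite take_path //=; move: pth; congr path.
rewrite (last_nth x0) size_takel; last by lia.
by rewrite -[x :: take d s]/(take d.+1 (x :: s)) nth_take.
Qed.

Lemma nth_rot0 i : i < k -> nth x0 (rot i p) 0 = v i.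
Proof. by move=> ik; rewrite /rot nth_cat size_drop subn_gt0 ik nth_drop addn0. Qed.

Lemma nth_rotD i d : i + d < k -> nth x0 (rot i p) d = v (i + d).
Proof.
move=> idk; rewrite /rot nth_cat size_drop; case: ltnP => h; last by lia.
by rewrite nth_drop.
Qed.

Lemma nth_rotB i j : i < j < k -> nth x0 (rot j p) (k - (j - i)) = v i.
Proof.
move=> ijk; rewrite /rot nth_cat size_drop; case: ltnP => h; first by lia.
have -> : k - (j - i) - (size p - j) = i by rewrite -/k; lia.
by rewrite nth_take //; lia.
Qed.

(** Both arcs between [v i] and [v j] are used. When both guards hold, adding the bounds gives
    [k <= 2 * size w + 2]: at most 4 for a common neighbour and 6 for two linked neighbours. *)
Lemma detour i j w : i < j < k -> uniq w -> all (fun y => y \notin T) w ->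
  all (fun y => y \notin p) w ->
  path (@adj G) (v j) (rcons w (v i)) -> path (@adj G) (v i) (rcons (rev w) (v j)) ->
  (2 < (j - i).+1 + size w -> k <= (j - i).+1 + size w) /\
  (2 < (k - (j - i)).+1 + size w -> k <= (k - (j - i)).+1 + size w).
Proof.
move=> ijk uw wT wp p1 p2; split=> s2.
  apply: (@arc_leq i) => //; try lia.
  by rewrite nth_rot0 ?nth_rotD; try lia; have -> : i + (j - i) = j by lia.
rewrite -(size_rev w); apply: (@arc_leq j); rewrite ?rev_uniq ?all_rev ?size_rev //; try lia.
by rewrite nth_rotB ?nth_rot0 //; lia.
Qed.

Lemma chord i j : i < j < k -> adj (v i) (v j) -> j = i.+1 \/ (i = 0 /\ j = k.-1).
Proof.
move=> ijk ij; have := @detour i j [::] ijk isT isT isT; rewrite /= !andbT adj_sym ij.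
by move=> /(_ isT isT) [] h1 h2; lia.
Qed.

Lemma adj_v i j : i < k -> j < k -> adj (v i) (v j) -> j = nx k i \/ i = nx k j.
Proof.
move=> ik jk ij; rewrite /nx; case: (ltngtP i j) => [lt|lt|eq].
- have ijk : i < j < k by rewrite lt.
  case: (chord ijk ij) => [->|[-> ->]]; [left|right]; case: eqP => //; lia.
- have jik : j < i < k by rewrite lt.
  rewrite adj_sym in ij; case: (chord jik ij) => [->|[-> ->]]; [right|left];
    case: eqP => //; lia.
- by rewrite eq adj_irr in ij.
Qed.

Lemma no_common_nbr i j y : i < j < k -> y \notin p -> y \notin T ->
  adj (v i) y -> adj (v j) y -> False.
Proof.
move=> ijk yp yT iy jy; have := @detour i j [:: y] ijk isT.
rewrite /= yT yp !andbT iy jy ![adj y _]adj_sym iy jy.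
by move=> /(_ isT isT isT isT) [] h1 h2; lia.
Qed.

Lemma no_linked_nbrs i j y z : i < j < k -> y \notin p -> y \notin T -> z \notin p ->
  z \notin T -> adj (v i) y -> adj (v j) z -> adj y z -> False.
Proof.
move=> ijk yp yT zp zT iy jz yz; have := @detour i j [:: z; y] ijk.
rewrite /= inE yT yp zT zp !andbT jz [adj z y]adj_sym yz iy.
rewrite [adj y (v i)]adj_sym iy [adj z (v j)]adj_sym jz.
rewrite eq_sym adj_neq // => /(_ isT isT isT isT isT) [] h1 h2.
by lia.
Qed.

Let third i := nbr (v i) :\: [set v (nx k i); v (pv k i)].
Let u i := odflt x0 [pick y in third i].

Lemma nx_pv_neq i : i < k -> nx k i != pv k i.
Proof. by rewrite /nx /pv => ik; apply/eqP; if_cases; lia. Qed.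

Lemma uP i : i < k -> u i \in third i.
Proof.
move=> ik; rewrite /u; case: pickP => //= none.
have := cardsD (nbr (v i)) [set v (nx k i); v (pv k i)]; rewrite -/(third i).
rewrite (eq_card0 none) (card_nbr3 hG cubic (v_out ik)) => h.
have : #|nbr (v i) :&: [set v (nx k i); v (pv k i)]| <= 2.
  by apply: leq_trans (subset_leq_card (subsetIr _ _)) _; rewrite cards2; case: eqP.
by lia.
Qed.

Lemma u_adj i : i < k -> adj (v i) (u i).
Proof. by move=> /uP /setDP[]; rewrite inE. Qed.

Lemma u_out i : i < k -> u i \notin T.
Proof. by move=> ik; apply: nbr_notin (v_out ik) (u_adj ik). Qed.

Lemma u_notin i : i < k -> u i \notin p.
Proof.
move=> ik; apply/negP => /(nthP x0)[j jk uj]; have ij := u_adj ik.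
have /setDP[_] := uP ik; rewrite -uj in ij *; rewrite -/(v j) in ij *.
have [->|e] := adj_v ik jk ij; first by rewrite set21.
by rewrite -(pv_nx jk) -e set22.
Qed.

Lemma nbr_v i y : i < k -> adj (v i) y -> [|| y == v (nx k i), y == v (pv k i) | y == u i].
Proof.
move=> ik iy; rewrite -[_ || _]negbK !negb_or; apply/negP => /and3P[n1 n2 n3].
have : size [:: y; v (nx k i); v (pv k i); u i] <= #|nbr (v i)|.
  apply: size_leq_nbr; last by rewrite /= iy v_adj ?v_adj_pv ?u_adj.
  have /setDP[_] := uP ik; rewrite in_set2 negb_or => /andP[u1 u2].
  rewrite /= !inE !negb_or n1 n2 n3 [v (nx k i) == u i]eq_sym u1 [v (pv k i) == u i]eq_sym u2.
  rewrite !andbT; apply/eqP => /v_inj => /(_ (nx_lt ik) (pv_lt ik)).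
  by apply/eqP/nx_pv_neq.
by rewrite (card_nbr3 hG cubic (v_out ik)).
Qed.

Lemma u_inj i j : i < k -> j < k -> u i = u j -> i = j.
Proof.
move=> ik jk uij; case: (ltngtP i j) => // lt; exfalso.
  apply: (@no_common_nbr i j (u i)); rewrite ?lt ?u_notin ?u_out ?u_adj //.
  by rewrite uij u_adj.
apply: (@no_common_nbr j i (u i)); rewrite ?lt ?u_notin ?u_out ?u_adj //.
by rewrite uij u_adj.
Qed.

Lemma u_nadj i j : i < k -> j < k -> ~~ adj (u i) (u j).
Proof.
move=> ik jk; apply/negP => uij; case: (ltngtP i j) => [lt|lt|eq].
- by apply: (@no_linked_nbrs i j (u i) (u j)); rewrite ?lt ?u_notin ?u_out ?u_adj.
- apply: (@no_linked_nbrs j i (u j) (u i)); rewrite ?lt ?u_notin ?u_out ?u_adj //.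
  by rewrite adj_sym.
- by rewrite eq adj_irr in uij.
Qed.

Lemma u_adj_v i j : i < k -> j < k -> adj (u i) (v j) -> i = j.
Proof.
move=> ik jk; rewrite adj_sym => /(nbr_v jk) /or3P[] /eqP e.
- by have := u_notin ik; rewrite e v_mem ?nx_lt.
- by have := u_notin ik; rewrite e v_mem ?pv_lt.
- exact: u_inj.
Qed.

Lemma u_neq_v i j : i < k -> j < k -> u i != v j.
Proof. by move=> ik jk; apply: contraNneq (u_notin ik) => ->; apply: v_mem. Qed.

Let rim i : {set G} := [set v i; v (nx k i)].
Let spoke i : {set G} := [set v i; u i].
Let es g := if odd g then spoke (nx k (pair_of k g)) else rim (pair_of k g).
Let S : {set G} := [set x in p].

Definition close i j := [|| j == i, j == nx k i | i == nx k j].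

Lemma near_v i j : i < k -> j < k -> (v i == v j) || adj (v i) (v j) -> close i j.
Proof.
move=> ik jk /orP[/eqP/v_inj ->|/(adj_v ik jk)[->|->]] //;
  by rewrite /close ?eqxx ?orbT.
Qed.

Lemma near_rim_rim i j : i < k -> j < k -> near (rim i) (rim j) ->
  [|| i == j, j == nx k i, i == nx k j, j == nx k (nx k i) | i == nx k (nx k j)].
Proof.
move=> ik jk /nearP[x [y []]]; rewrite !in_set2.
have nik := nx_lt ik; have njk := nx_lt jk.
have := nxP ik; have := nxP jk; have := nxP nik; have := nxP njk.
move=> n1 n2 n3 n4 /orP[]/eqP -> /orP[]/eqP -> /near_v h;
  by have {h} := h ltac:(done) ltac:(done); rewrite /close; lia.
Qed.

Lemma near_rim_spoke i j : i < k -> j < k -> near (rim i) (spoke j) ->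
  [|| j == i, j == nx k i, i == nx k j | j == nx k (nx k i)].
Proof.
move=> ik jk /nearP[x [y []]]; rewrite !in_set2.
have uv a : a < k -> (v a == u j) || adj (v a) (u j) -> a = j.
  move=> ak; rewrite eq_sym (negbTE (u_neq_v jk ak)) adj_sym => /u_adj_v -> //.
move=> /orP[]/eqP -> /orP[]/eqP ->.
- by move=> /near_v => /(_ ik jk); rewrite /close => /or3P[] ->; rewrite ?orbT.
- by move=> /(uv _ ik) ->; rewrite eqxx.
- move=> /near_v => /(_ (nx_lt ik) jk).
  have := nxP ik; have := nxP jk; have := nxP (nx_lt ik).
  by rewrite /close; lia.
- by move=> /(uv _ (nx_lt ik)) <-; rewrite eqxx orbT.
Qed.

Lemma near_spoke_spoke i j : i < k -> j < k -> near (spoke i) (spoke j) -> close i j.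
Proof.
move=> ik jk /nearP[x [y []]]; rewrite !in_set2.
move=> /orP[]/eqP -> /orP[]/eqP ->.
- exact: near_v.
- rewrite eq_sym (negbTE (u_neq_v jk ik)) adj_sym => /u_adj_v <- //.
  by rewrite /close eqxx.
- by rewrite (negbTE (u_neq_v ik jk)) => /u_adj_v -> //; rewrite /close eqxx.
- by rewrite (negbTE (u_nadj ik jk)) orbF => /eqP /u_inj -> //; rewrite /close eqxx.
Qed.

(** Each conflict is listed in the block of the pair that comes first along the cycle. *)
Lemma es_paired g h : g < k.*2 -> h < k.*2 -> es g != es h -> near (es g) (es h) ->
  paired k g h.
Proof.
move=> gk hk; rewrite /es (pair_posK k7 gk) (pair_posK k7 hk) !pair_ofK ?pair_of_lt //.
have := pair_of_lt k7 gk; have := pair_of_lt k7 hk.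
move: (pair_of k g) (pair_of k h) (odd g) (odd h) => i j og oh jk ik.
rewrite !odd_pair_pos; have nik := nx_lt ik; have njk := nx_lt jk.
have inj a b : a < k -> b < k -> nx k a = nx k b -> a = b.
  by move=> ak bk e; rewrite -(pv_nx ak) e pv_nx.
have rim_spoke a b : a < k -> b < k -> near (rim a) (spoke (nx k b)) ->
    paired k (pair_pos k a + false) (pair_pos k b + true).
  move=> ak bk /(near_rim_spoke ak (nx_lt bk)) /or4P[] /eqP e.
  - rewrite paired_sym; apply: (pairedW k7 bk).
    by rewrite -e addn0 addn1 /pair_block /wblock !inE eqxx !orbT.
  - have ab := inj _ _ bk ak e; rewrite ab; apply: (pairedW k7 ak).
    by rewrite addn0 addn1 /pair_block /wblock !inE eqxx.
  - rewrite paired_sym; apply: (pairedW k7 bk).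
    by rewrite e addn0 addn1 /pair_block /wblock !inE eqxx !orbT.
  - have ab := inj _ _ bk (nx_lt ak) e; rewrite ab; apply: (pairedW k7 ak).
    by rewrite addn0 addn1 /pair_block /wblock !inE eqxx !orbT.
case: og; case: oh.
- move=> ne /(near_spoke_spoke nik njk) /or3P[] /eqP e.
  + by rewrite e eqxx in ne.
  + rewrite (inj _ _ jk nik e); apply: (pairedW k7 ik).
    by rewrite !addn1 /pair_block /wblock !inE eqxx !orbT.
  + rewrite (inj _ _ ik njk e) paired_sym; apply: (pairedW k7 jk).
    by rewrite !addn1 /pair_block /wblock !inE eqxx !orbT.
- by move=> _; rewrite near_sym paired_sym; apply: rim_spoke.
- by move=> _; apply: rim_spoke.
- move=> ne; rewrite !addn0 => /(near_rim_rim ik jk) /or4P[/eqP e|/eqP ->|/eqP ->|/orP[] /eqP ->].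
  + by rewrite e eqxx in ne.
  + by apply: (pairedW k7 ik); rewrite /pair_block /wblock !inE eqxx !orbT.
  + by rewrite paired_sym; apply: (pairedW k7 jk); rewrite /pair_block /wblock !inE eqxx !orbT.
  + by apply: (pairedW k7 ik); rewrite /pair_block /wblock !inE eqxx !orbT.
  + by rewrite paired_sym; apply: (pairedW k7 jk); rewrite /pair_block /wblock !inE eqxx !orbT.
Qed.

Lemma u_free i : i < k -> #|nbr (u i) :\: (T :|: S)| <= 2.
Proof.
move=> ik; have := cardsD1 (v i) (nbr (u i)); rewrite inE adj_sym u_adj // => h.
have sub : nbr (u i) :\: (T :|: S) \subset nbr (u i) :\ v i.
  apply/subsetP => y /setDP[yu]; rewrite in_setU negb_or in_setD1 yu andbT => /andP[_].
  by apply: contraNneq => ->; rewrite inE v_mem.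
by apply: leq_trans (subset_leq_card sub) _; have := card_nbr hG (u i); lia.
Qed.

(** Off the cycle only the two third neighbours are reached, each with at most two edges avoiding
    the cycle. *)
Lemma out_rim i : i < k -> #|out (T :|: S) (rim i)| <= 4.
Proof.
move=> ik; have nik := nx_lt ik; apply: leq_trans (card_out _ (v_adj ik)) _.
apply: leq_trans (leq_sum_subseq (s := [:: u i; u (nx k i)]) _ _) _; last first.
  by rewrite !big_cons big_nil addn0; have := u_free ik; have := u_free nik; lia.
move=> c /setDP[h]; rewrite !in_setU !negb_or inE => /andP[/andP[_ cp'] _].
move: h; rewrite !in_setU ![_ \in nbr _]inE => /orP[/(nbr_v ik)|/(nbr_v nik)] /or3P[] /eqP e;
  try (by rewrite e inE v_mem ?nx_lt ?pv_lt // in cp').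
  by rewrite e mem_head.
by rewrite e !inE eqxx orbT.
Qed.

(** Only the two further neighbours of [u i] are reached, with at most three edges each. *)
Lemma out_spoke i : i < k -> #|out (T :|: S) (spoke i)| <= 6.
Proof.
move=> ik; apply: leq_trans (card_out _ (u_adj ik)) _.
have sub : {subset reach (v i) (u i) (T :|: S) <= enum (nbr (u i) :\ v i)}.
  move=> c /setDP[h]; rewrite !in_setU !negb_or inE => /andP[/andP[_ cp'] cvu].
  rewrite mem_enum in_setD1; move: cvu; rewrite !inE => /andP[-> cu] /=.
  move: h; rewrite !inE => /orP[|//] /(nbr_v ik) /or3P[] /eqP e.
  - by rewrite e inE v_mem ?nx_lt in cp'.
  - by rewrite e inE v_mem ?pv_lt in cp'.
  - by rewrite e eqxx in cu.
apply: leq_trans (leq_sum_subseq _ sub) _.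
apply: leq_trans (_ : \sum_(c <- enum (nbr (u i) :\ v i)) 3 <= _).
  by apply: leq_sum => c _; apply: leq_trans (card_nbr hG c); apply/subset_leq_card/subsetDl.
rewrite big_const_seq iter_addn_0 count_predT -cardE.
have := cardsD1 (v i) (nbr (u i)); rewrite inE adj_sym u_adj // => h.
by have := card_nbr hG (u i); lia.
Qed.

Lemma colorable_long_cycle : colorable L (free T).
Proof.
have n2k : (k - 4).*2.+4.+4 = k.*2 by lia.
have r3 : 3 <= k - 4 by lia.
have bE := below_sun_pairs (k - 4); have nz := acoef_sun_neq0 r3.
rewrite n2k in bE nz.
apply: (colorable_configuration hL IHT (es := es) (S := S) _ _ bE nz).
- by apply/set0Pn; exists (v 0); rewrite inE v_mem //; lia.
- by apply/pred0P => x /=; rewrite inE; apply/negP => /andP[/(allP pT) /negP].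
- move=> g gk; have ik := pair_of_lt k7 gk; apply/pred0Pn; rewrite /es.
  case: ifP => _; first by exists (v (nx k (pair_of k g))); rewrite /= !inE eqxx v_mem ?nx_lt.
  by exists (v (pair_of k g)); rewrite /= !inE eqxx v_mem.
- move=> e; rewrite inE => /andP[eE _] /pred0Pn[x /=]; rewrite inE => /andP[xe].
  case/(nthP x0) => i ik xi; rewrite -/k -/(v i) in ik xi.
  have [y xy ey] := edge_set_with eE xe; rewrite -xi in xy ey.
  case/or3P: (nbr_v ik xy) => /eqP yi.
  + exists (pair_pos k i + false); first exact: pair_pos_lt.
    by rewrite /es odd_pair_pos pair_ofK // ey yi.
  + exists (pair_pos k (pv k i) + false); first by rewrite pair_pos_lt ?pv_lt.
    by rewrite /es odd_pair_pos pair_ofK ?pv_lt // ey yi /rim nx_pv // setUC.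
  + exists (pair_pos k (pv k i) + true); first by rewrite pair_pos_lt ?pv_lt.
    by rewrite /es odd_pair_pos pair_ofK ?pv_lt // nx_pv // ey yi.
- move=> g gk; have ik := pair_of_lt k7 gk; have := chain_exp_le k g; rewrite /es.
  case: ifP => _ h.
    exact: leq_trans (leq_add h (out_spoke (nx_lt ik))) _.
  exact: leq_trans (leq_add h (out_rim ik)) _.
- exact: es_paired.
Qed.

End LongCycles.

(** * Main induction *)

Section MainInduction.
Variable G : sgraph.
Hypothesis hG : subcubic G.
Variable L : {set G} -> seq nat.
Hypothesis hL : forall e, uniq (L e) /\ 10 <= size (L e).

Section CubicPart.
Variable T : {set G}.
Hypothesis cubic : forall x : G, x \notin T -> #|nbr x :\: T| = 3.

Definition cycle_off (q : seq G) : bool :=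
  [&& uniq q, cycle (@adj G) q & all (fun x => x \notin T) q].

(* Every neighbour of an end of a longest path lies on that path. *)
Lemma ex_cycle (x : G) (p : seq G) : path (@adj G) x p -> uniq (x :: p) ->
  all (fun y => y \notin T) (x :: p) -> exists2 q, cycle_off q & 2 < size q.
Proof.
have [n] := ubnP (#|G| - size p); elim: n x p => // n IH x p szp xp ux /= /andP[xT pT].
have sp : size p < #|G|.
  by have := card_uniqP ux => /= <-; apply: max_card.
have [/exists_inP[y yx yp]|none] := boolP [exists y in nbr x, y \notin x :: p].
  rewrite inE in yx; apply: (IH y (x :: p)) => /=.
  - by move: szp sp; move: #|_| (size p) => a b; lia.
  - by rewrite adj_sym yx.
  - by rewrite yp.
  - by rewrite xT pT (nbr_notin hG cubic xT yx).
have onp y : adj x y -> y \in p.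
  move=> xy; apply: contraNT none => yp; apply/exists_inP; exists y; rewrite inE //.
  by rewrite negb_or yp andbT eq_sym adj_neq.
(* Avoiding the next vertex of the path gives the closed cycle at least three vertices. *)
have [y xy yh] : exists2 y, adj x y & y != head x p.
  have : 0 < #|nbr x :\ head x p|.
    have := cardsD1 (head x p) (nbr x); rewrite (card_nbr3 hG cubic xT).
    by case: (_ \in _) => /=; lia.
  by case/card_gt0P=> y; rewrite !inE => /andP[yh xy]; exists y.
have yp := onp y xy; case/splitPr: yp xp ux pT yh {sp szp none onp} => p1 p2 xp ux pT yh.
have xp1 : path (@adj G) x (rcons p1 y) by move: xp; rewrite -cat_rcons cat_path => /andP[].
have up1 : uniq (x :: rcons p1 y).
  by move: ux; rewrite -cat_rcons -cat_cons cat_uniq => /and3P[].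
have p1T : all (fun z => z \notin T) (rcons p1 y).
  by move: pT; rewrite -cat_rcons all_cat => /andP[].
exists (x :: rcons p1 y).
  by rewrite /cycle_off up1 [cycle _ _]/= rcons_path xp1 last_rcons adj_sym xy /= xT p1T.
by case: p1 yh {xp xp1 ux up1 pT p1T} => [|a p1] /=; rewrite ?eqxx // size_rcons.
Qed.

Lemma shortest_cycle : T != [set: G] -> exists q, [/\ cycle_off q, 2 < size q &
  forall q' : seq G, 2 < size q' < size q -> all (fun x => x \notin T) q' -> uniq q' ->
    ~~ cycle (@adj G) q'].
Proof.
move=> TG; have [x xT] : exists x, x \notin T.
  apply/existsP; apply: contraNT TG; rewrite negb_exists => /forallP h.
  by apply/eqP/setP => x; rewrite inE; have := h x; rewrite negbK.
have xT1 : all (fun y => y \notin T) [:: x] by rewrite /= xT.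
have [q qc q2] := @ex_cycle x [::] isT isT xT1.
(* Tuples of fixed length form a finite type, so [P] is boolean and has a least witness. *)
pose P n := (2 < n) && [exists t : n.-tuple G, cycle_off t].
have exP : exists n, P n.
  by exists (size q); rewrite /P q2; apply/existsP; exists (in_tuple q).
case: (ex_minnP exP) => n /andP[n2 /existsP[t tc]] minn.
exists (tval t); split; rewrite ?size_tuple // => q' /andP[q'2 q'n] q'T uq'.
apply/negP => cq'; have := minn (size q'); rewrite leqNgt q'n => /(_ _)/negP; apply=> //.
by rewrite /P q'2; apply/existsP; exists (in_tuple q'); rewrite /cycle_off uq' cq' q'T.
Qed.

End CubicPart.

Lemma realizes_mcycle (T : {set G}) (x0 : G) (q : seq G) :
  cycle_off T q -> 0 < size q -> realizes T (mcycle (size q)) (nth x0 q).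
Proof.
case/and3P=> uq cq /allP qT q0; split=> //= [i j iq jq /eqP|i iq|i j].
- by rewrite nth_uniq // => /eqP.
- by apply: qT; apply: mem_nth.
- case/mapP=> a; rewrite mem_iota add0n => /= aq [-> ->].
  have -> : a.+1 %% size q = nx (size q) a.
    by rewrite /nx; case: eqP => [->|ne]; [rewrite modnn|rewrite modn_small //; lia].
  by split; rewrite ?nx_lt //; apply: cycle_nth.
Qed.

Lemma certified_cycles :
  [&& certified 3 (mcycle 3) cert3, certified 4 (mcycle 4) cert4,
      certified 5 (mcycle 5) cert5 & certified 6 (mcycle 6) cert6].
Proof. by vm_cast_no_check (erefl true). Qed.

Lemma certified_short g : 2 < g < 7 -> exists c, certified g (mcycle g) c.
Proof.
move=> g27; have : g \in [:: 3; 4; 5; 6] by rewrite !inE; lia.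
have /and4P[c3 c4 c5 c6] := certified_cycles.
rewrite !inE => /or4P[] /eqP ->.
- by exists cert3; exact c3.
- by exists cert4; exact c4.
- by exists cert5; exact c5.
- by exists cert6; exact c6.
Qed.

(** Induction on the number of vertices outside [T]. Either one of them has at most two neighbours
    outside [T], or the rest is cubic and contains a shortest cycle; in both cases [T] is enlarged.
    When [T] is everything, no edge is left. *)
Theorem colorable_free (T : {set G}) : colorable L (free T).
Proof.
have [n] := ubnP #|~: T|; elim: n T => // n IH T szT.
have IHT (T' : {set G}) : T \proper T' -> colorable L (free T').
  move=> TT'; apply: IH; rewrite -ltnS; apply: leq_trans szT.
  by rewrite ltnS; apply: proper_card; rewrite properC.
have [/existsP[x /andP[xT dx]]|cub] :=
    boolP [exists x, (x \notin T) && (#|nbr x :\: T| <= 2)].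
  apply: (colorable_vertex hG hL xT dx); apply: IHT.
  by rewrite properUr // sub1set.
have cubic (x : G) : x \notin T -> #|nbr x :\: T| = 3.
  move=> xT; apply/eqP; rewrite eqn_leq.
  rewrite (leq_trans (subset_leq_card (subsetDl _ _)) (card_nbr hG x)) ltnNge.
  by apply: contra cub => dx; apply/existsP; exists x; rewrite xT.
have [TG|TG] := eqVneq T [set: G].
  have empty e : e \notin free T.
    rewrite inE TG; apply/negP => /andP[/edge_setP[x [y [_ ->]]]].
    by rewrite -setI_eq0 setIT => /eqP/setP/(_ x); rewrite !inE eqxx.
  by exists (fun=> 0) => [e|e f] eT; move: (empty e); rewrite eT.
have [q [qc q2 girth]] := shortest_cycle cubic TG.
have [x0 _] : exists x : G, x \in q by case: q q2 {qc girth} => // x q _; exists x; rewrite mem_head.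
have rq := realizes_mcycle x0 qc (ltnW (ltnW q2)).
have [k7|k6] := leqP 7 (size q).
  case/and3P: qc => uq cq qT.
  exact: (colorable_long_cycle hG hL cubic IHT x0 uq cq qT girth k7).
have [|c cc] := @certified_short (size q); first by rewrite q2.
exact: (certified_sound hG hL cubic IHT girth rq cc).
Qed.

End MainInduction.

(** * From lists of numbers to lists of arbitrary colours *)

Lemma strong_near (G : sgraph) (e f : edge G) :
  adjacent e f \/ (exists g : edge G, adjacent g e /\ adjacent g f) ->
  near (val e) (val f).
Proof.
case=> [/andP[_ /existsP[x /andP[xe xf]]]|[h [/andP[_ /existsP[x /andP[xh xe]]]]]].
  by apply/nearP; exists x, x; rewrite eqxx.
case/andP=> _ /existsP[y /andP[yh yf]]; apply/nearP; exists x, y; split=> //.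
have [z xz hz] := edge_set_with (valP h) xh.
by move: yh; rewrite hz !inE => /orP[] /eqP ->; rewrite ?eqxx // xz orbT.
Qed.

From mathcomp Require Import boolp classical_sets functions cardinality.

Lemma choosable10 (G : sgraph) : subcubic G -> strongly_edge_choosable G 10.
Proof.
move=> hG C L HL.
have /choice[f Hf] : forall e : edge G, exists f : nat -> C,
    (forall i, i < 10 -> L e (f i)) /\
    (forall i j, i < 10 -> j < 10 -> f i = f j -> i = j).
  move=> e; have /card_leP[f] := HL e.
  pose i0 : `I_10 := SigSub (mem_set (ltn0Sn _ : `I_10 0)).
  exists (fun i => set_val (f (insubd i0 i))); split=> [i ilt|i j ilt jlt].
    exact: set_valP.
  move/val_inj/(inj (in_setT _) (in_setT _))/(congr1 val).
  by rewrite !val_insubd !mem_set.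
pose row (e : edge G) : seq {classic C} := [seq f e i : {classic C} | i <- iota 0 10].
(* Ten colours per edge give a finite palette, in which the index serves as a numerical code. *)
pose cols : seq {classic C} := flatten [seq row e | e <- enum {: edge G}].
have colsP e i : i < 10 -> (f e i : {classic C}) \in cols.
  move=> ilt; apply/flattenP; exists (row e).
    by apply: map_f; rewrite mem_enum.
  by apply: (map_f (fun i => f e i : {classic C})); rewrite mem_iota.
(* Numerical lists are indexed by all vertex sets, so sets that are not edges get an arbitrary list
   of ten. *)
pose M (s : {set G}) : seq nat :=
  if insub s is Some e then [seq index (f e i : {classic C}) cols | i <- iota 0 10]
  else iota 0 10.
have ME (e : edge G) : M (val e) = [seq index (f e i : {classic C}) cols | i <- iota 0 10].
  by rewrite /M valK.
have hM s : uniq (M s) /\ 10 <= size (M s).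
  rewrite /M; case: insubP => [e _ _|_]; last by rewrite iota_uniq size_iota.
  rewrite size_map size_iota map_inj_in_uniq ?iota_uniq // => i j.
  rewrite !mem_iota !add0n => /= ilt jlt ij.
  have [_ inj] := Hf e; apply: inj => //.
  have := nth_index (f e i : {classic C}) (colsP e i ilt).
  by rewrite ij nth_index ?colsP.
have [psi psiM psiC] := colorable_free hG hM finset.set0.
have inF (e : edge G) : val e \in free (finset.set0 : {set G}).
  by rewrite inE (valP e) -setI_eq0 finset.setI0 eqxx.
(* The default is taken from the list of [e], since [C] may be empty when there is no edge. *)
pose phi (e : edge G) : C := nth (f e 0 : {classic C}) cols (psi (val e)).
have phiP e : exists2 i, i < 10 & phi e = f e i /\ psi (val e) = index (f e i : {classic C}) cols.
  have := psiM _ (inF e); rewrite ME => /mapP[i]; rewrite mem_iota add0n => /= ilt pe.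
  by exists i => //; split=> //; rewrite /phi pe nth_index ?colsP.
exists phi; split=> [e e' ee' h|e].
  move=> pp; have [i ilt [pe pse]] := phiP e; have [j jlt [pe' pse']] := phiP e'.
  have := psiC _ _ (inF e) (inF e') _ (strong_near h).
  by rewrite (inj_eq val_inj) => /(_ ee'); rewrite pse pse' -pe -pe' pp eqxx.
by have [i ilt [-> _]] := phiP e; have [h _] := Hf e; apply: h.
Qed.

Theorem theorem3p5 (G : sgraph) (hG : subcubic G) :
  strong_list_chromatic_index G <= 10 /\ strongly_edge_choosable G 10.
Proof.
have ch := choosable10 hG; split=> //; rewrite /strong_list_chromatic_index.
by case: ex_minnP => k _; apply; apply/asboolP.
Qed.
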